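(* Let $A$ be a unital super-commutative associative superalgebra over $\mathbb{C}$, let $B$ be a vertex $A$-superalgebroid, and let $V_B$ be the associated $\mathbb{N}$-graded vertex superalgebra, with $(V_B)_{(0)}=A$ and $(V_B)_{(1)}=B$. Suppose that the superspace $A\oplus B$ is equipped with a weight $\mathfrak{b}$-module structure (by even operators) with $L(0)|_A=0$, $L(0)|_B=1$, such that $L(1)\partial A=0$ and $$L(1)(u_0v)=(L(1)u)_0v+u_0(L(1)v)\quad\text{for } u,v\in B,$$ $$L(1)(ab)=aL(1)b-a_0b\quad\text{for } a\in A,\ b\in B.$$ Then the $\mathfrak{b}$-module structure on $A+B$ can be extended to a $Vir^+$-module structure on $V_B$, which is uniquely determined by $$L(-1)=\mathcal{D},\qquad [L(m),Y(u,x)]=\sum_{i=0}^{2}\binom{m+1}{i}x^{m+1-i}\,Y(L(i-1)u,x)$$ for $u\in A+B$ and integers $m\ge -1$. Furthermore, $V_B$ is a semi-conformal vertex superalgebra.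
   Context: Signs: for homogeneous $u,v$ in superspaces, $\varepsilon_{u,v}=(-1)^{|u||v|}$, where $|u|\in\{0,1\}$ is the parity; formulas involving parities are for homogeneous elements. Leibniz superalgebra: a superspace $\Gamma$ with an even bilinear bracket satisfying $[u,[v,w]]=[[u,v],w]+\varepsilon_{u,v}[v,[u,w]]$. ${\rm Der}(A)$ is the Lie superalgebra of superderivations of $A$: $D$ of degree $s$ satisfies $D(ab)=D(a)b+(-1)^{s|a|}aD(b)$. Vertex $A$-superalgebroid ($A$ a unital super-commutative associative superalgebra over $\mathbb{C}$): a superspace $\Gamma$ with parity-compatible structure maps: a bilinear map $A\times\Gamma\to\Gamma$, $(a,v)\mapsto a*v$, with $1*v=v$; a Leibniz superalgebra bracket $[\cdot,\cdot]$ on $\Gamma$; a homomorphism of Leibniz superalgebras $\pi:\Gamma\to{\rm Der}(A)$; a bilinear pairing $\langle\cdot,\cdot\rangle:\Gamma\otimes\Gamma\to A$ with $\langle u,v\rangle=\varepsilon_{u,v}\langle v,u\rangle$; a linear map $\partial:A\to\Gamma$ with $\pi\circ\partial=0$; such that for $a,a'\in A$, $u,v,v_1,v_2\in\Gamma$: $a*(a'*v)-(aa')*v=\varepsilon_{a,a'}\pi(v)(a)*\partial(a')+\pi(v)(a')*\partial(a)$; $[u,a*v]=\pi(u)(a)*v+\varepsilon_{u,a}a*[u,v]$; $[u,v]+\varepsilon_{u,v}[v,u]=\partial(\langle u,v\rangle)$; $\pi(a*v)=a\pi(v)$; $\langle a*u,v\rangle=a\langle u,v\rangle-\varepsilon_{a,u}\varepsilon_{a,v}\pi(u)(\pi(v)(a))$;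 $\pi(v)(\langle v_1,v_2\rangle)=\langle[v,v_1],v_2\rangle+\varepsilon_{v,v_1}\langle v_1,[v,v_2]\rangle$; $\partial(aa')=a*\partial(a')+\varepsilon_{a,a'}a'*\partial(a)$; $[v,\partial(a)]=\partial(\pi(v)(a))$; $\langle v,\partial(a)\rangle=\pi(v)(a)$. For a vertex $A$-superalgebroid $B$ write $ab=a*b$ and, on $A\oplus B$, set $a_ia'=0$ ($i=0,1$), $u_0v=[u,v]$, $u_1v=\langle u,v\rangle$, $u_0a=\pi(u)(a)$, $a_0u=-\varepsilon_{u,a}\pi(u)(a)$ for $a,a'\in A$, $u,v\in B$. Lie superalgebra $\mathcal{L}$: on $L(A\oplus B)=(A\oplus B)\otimes\mathbb{C}[t,t^{-1}]$ put $[a\otimes t^m,a'\otimes t^n]=0$, $[a\otimes t^m,b\otimes t^n]=a_0b\otimes t^{m+n}$, $[b\otimes t^n,a\otimes t^m]=b_0a\otimes t^{m+n}$, $[b\otimes t^m,b'\otimes t^n]=b_0b'\otimes t^{m+n}+m(b_1b')\otimes t^{m+n-1}$. Let $\hat\partial=\partial\otimes1+1\otimes d/dt:L(A)=A\otimes\mathbb{C}[t,t^{-1}]\to L(A\oplus B)$. Then $\mathcal{L}=\mathcal{L}(A\oplus B)=L(A\oplus B)/\hat\partial L(A)$ is a Lie superalgebra; it is $\mathbb{Z}$-graded by $\deg(a\otimes t^n)=-n-1$, $\deg(b\otimes t^n)=-n$. Let $u(n)$ be the image of $u\otimes t^n$ and $\mathcal{L}^{\ge0}$ the span of all $u(n)$,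 $u\in A\oplus B$, $n\ge0$. $V_{\mathcal{L}}=U(\mathcal{L})\otimes_{U(\mathcal{L}^{\ge0})}\mathbb{C}$ ($\mathbb{C}$ the trivial module), $\mathbf{1}=1\otimes1$ of degree $0$; $A\oplus B$ is identified with a subspace via $u\mapsto u(-1)\mathbf{1}$. $V_{\mathcal{L}}$ has a unique vertex superalgebra structure with vacuum $\mathbf{1}$ and $Y(u,x)=\sum_{n\in\mathbb{Z}}u(n)x^{-n-1}$ for $u\in A\oplus B$, and is $\mathbb{N}$-graded. In any vertex superalgebra, $Y(v,x)=\sum_n v_nx^{-n-1}$ and $\mathcal{D}(v)=v_{-2}\mathbf{1}$. With $e$ the identity of $A$, let $E={\rm span}\{e-\mathbf{1},\ a(-1)a'-aa',\ a(-1)b-ab\mid a,a'\in A,\ b\in B\}\subset V_{\mathcal{L}}$, and $I_B=U(\mathcal{L})\mathbb{C}[\mathcal{D}]E$, a graded two-sided ideal. Then $V_B=V_{\mathcal{L}}/I_B$. Standing assumption: $(V_B)_{(0)}=A$ and $(V_B)_{(1)}=B$ under $u\mapsto u(-1)\mathbf{1}$; $V_B$ is generated by $A\oplus B$ as a vertex superalgebra. $Vir$ is the Virasoro algebra with basis $\{L_n\}_{n\in\mathbb{Z}}\cup\{c\}$, $[L_m,L_n]=(m-n)L_{m+n}+\frac1{12}(m^3-m)\delta_{m+n,0}c$, $c$ central; $Vir^+={\rm span}\{L_m\mid m\ge-1\}$; $\mathfrak{b}={\rm span}\{L_0,L_1\}$. $L(n)$ denotes the operator by which $L_n$ acts. A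 weight $\mathfrak{b}$-module is one on which $L(0)$ acts semisimply. Semi-conformal vertex superalgebra: a vertex superalgebra $V$ with a $Vir^+$-module structure such that $V=\bigoplus_{n\in\mathbb{Z}}V_{(n)}$ with $V_{(n)}=\{v\mid L(0)v=nv\}$, $V_{(-n)}=0$ for $n$ sufficiently large, $L(-1)=\mathcal{D}$ on $V$, and $[L(m),Y(v,x)]=\sum_{i\ge0}\binom{m+1}{i}x^{m+1-i}Y(L(i-1)v,x)$ for all integers $m\ge-1$ and $v\in V$. *)

(* Defs.v *)
From HB Require Import structures.
From mathcomp Require Import all_boot all_order all_algebra.
From mathcomp Require Import generic_quotient ring_quotient finmap monalg complex.
From mathcomp Require Import boolp reals.

Set Implicit Arguments.
Unset Strict Implicit.
Unset Printing Implicit Defensive.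

Import Order.TTheory GRing.Theory Num.Theory.
Local Open Scope ring_scope.
Local Open Scope quotient_scope.

Section LinearMaps.
Variables (K : fieldType) (V W : lmodType K) (f : V -> W).
Hypothesis f_lin : linear f.

Lemma lin0 : f 0 = 0.
Proof. by have := f_lin (-1) 0 0; rewrite scaler0 addr0 scaleN1r addNr. Qed.
Lemma linZ c u : f (c *: u) = c *: f u.
Proof. by have := f_lin c u 0; rewrite lin0 !addr0. Qed.
Lemma linD u v : f (u + v) = f u + f v.
Proof. by have := f_lin 1 u v; rewrite !scale1r. Qed.
Lemma linB u v : f (u - v) = f u - f v.
Proof. by rewrite -scaleN1r addrC f_lin scaleN1r addrC. Qed.
Lemma lin_sum (I : Type) (r : seq I) (F : I -> V) :
  f (\sum_(i <- r) F i) = \sum_(i <- r) f (F i).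
Proof. exact: (big_morph f linD lin0). Qed.

End LinearMaps.

Section Quotients.
Context {K : fieldType}.

Inductive lin_span (V : lmodType K) (S : V -> Prop) : V -> Prop :=
| Span0 : lin_span S 0
| SpanZD c u v : S u -> lin_span S v -> lin_span S (c *: u + v).

Lemma span_linear (V : lmodType K) (S : V -> Prop) c u v :
  lin_span S u -> lin_span S v -> lin_span S (c *: u + v).
Proof.
move=> Su Sv; elim: Su => [|d x y Sx _ IH]; first by rewrite scaler0 add0r.
by rewrite scalerDr scalerA -addrA; exact: SpanZD.
Qed.

Lemma span_gen (V : lmodType K) (S : V -> Prop) u : S u -> lin_span S u.
Proof.
move=> Su; rewrite -[u]scale1r -[X in lin_span _ X]addr0.
by apply: SpanZD => //; exact: Span0.
Qed.

Lemma span_sum (V : lmodType K) (S : V -> Prop) (I : Type) (r : seq I)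
    (F : I -> V) :
  (forall i, lin_span S (F i)) -> lin_span S (\sum_(i <- r) F i).
Proof.
move=> h; elim/big_ind: _ => [||//]; first exact: Span0.
by move=> x y; rewrite -{2}[x]scale1r; exact: span_linear.
Qed.

Lemma span_map (V W : lmodType K) (S : V -> Prop) (S' : W -> Prop)
    (f : V -> W) u :
  linear f -> (forall x, S x -> lin_span S' (f x)) ->
  lin_span S u -> lin_span S' (f u).
Proof.
move=> f_lin h; elim=> {u} [|c x y Sx _ IH].
  by rewrite (lin0 f_lin); exact: Span0.
by rewrite f_lin; apply: span_linear => //; exact: h.
Qed.

Definition span_pred (V : lmodType K) (S : V -> Prop) : {pred V} :=
  fun v => `[< lin_span S v >].

Fact span_zmod_closed (V : lmodType K) (S : V -> Prop) :
  zmod_closed (span_pred S).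
Proof.
split=> [|u v]; first exact/asboolP/Span0.
move=> /asboolP Su /asboolP Sv; apply/asboolP.
by rewrite addrC -scaleN1r; exact: span_linear.
Qed.

HB.instance Definition _ (V : lmodType K) (S : V -> Prop) :=
  GRing.isZmodClosed.Build V (span_pred S) (span_zmod_closed S).

(* V / span S *)
Definition quotv (V : lmodType K) (S : V -> Prop) : Type :=
  Quotient.quot (span_pred S).

Section QuotvLmod.
Variables (V : lmodType K) (S : V -> Prop).

HB.instance Definition _ := GRing.Zmodule.on (quotv S).

Definition qpi (v : V) : quotv S := \pi_(Quotient.quot (span_pred S)) v.
Definition qrepr (x : quotv S) : V := repr (x : Quotient.quot (span_pred S)).

Lemma qreprK x : qpi (qrepr x) = x. Proof. exact: reprK. Qed.

Lemma qpi_eq u v : (qpi u = qpi v) <-> lin_span S (u - v).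
Proof.
split=> [/eqP|h]; last by apply/eqP; rewrite -Quotient.idealrBE; apply/asboolP.
by rewrite -Quotient.idealrBE => /asboolP.
Qed.

Lemma qpiD u v : qpi (u + v) = qpi u + qpi v.
Proof. exact: (raddfD (\pi_(Quotient.quot (span_pred S)))). Qed.

Definition qscale (c : K) (x : quotv S) : quotv S := qpi (c *: qrepr x).

Lemma qpiZ c v : qpi (c *: v) = qscale c (qpi v).
Proof.
apply/qpi_eq; rewrite -scalerBr -[X in lin_span _ X]addr0.
by apply: span_linear; [apply/qpi_eq; rewrite qreprK | exact: Span0].
Qed.

Fact qscaleA a b x : qscale a (qscale b x) = qscale (a * b) x.
Proof. by rewrite -[x]qreprK -!qpiZ scalerA. Qed.
Fact qscale1 : left_id 1 qscale.
Proof. by move=> x; rewrite -[x]qreprK -!qpiZ scale1r. Qed.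
Fact qscaleDr : right_distributive qscale +%R.
Proof.
by move=> a x y; rewrite -[x]qreprK -[y]qreprK -qpiD -!qpiZ scalerDr qpiD.
Qed.
Fact qscaleDl x : {morph qscale^~ x : a b / a + b}.
Proof. by move=> a b; rewrite -[x]qreprK -!qpiZ scalerDl qpiD. Qed.

HB.instance Definition _ := GRing.Zmodule_isLmodule.Build K (quotv S)
  qscaleA qscale1 qscaleDr qscaleDl.

End QuotvLmod.
End Quotients.

(* The free associative algebra on X. *)
Definition freealg (K : fieldType) (X : choiceType) : Type :=
  {malg K[{fmonom X}]}.

Section FreeAlg.
Variables (K : fieldType) (X : choiceType).

HB.instance Definition _ := GRing.Lalgebra.on (freealg K X).

Definition fgen (x : X) : freealg K X := << fmu x >>.

Fact freealg_scalerAr (c : K) (x y : freealg K X) :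
  c *: (x * y) = x * (c *: y).
Proof.
apply/malgP => k; rewrite mcoeffZ.
rewrite [in RHS](mcoeffMlw _ (fsubset_refl _) (msuppZ_le c y)) mcoeffMl.
rewrite mulr_sumr; apply: eq_bigr => i _; rewrite mulr_sumr; apply: eq_bigr => j _.
by rewrite mcoeffZ -mulrnAr mulrCA !mulrnAr.
Qed.

HB.instance Definition _ :=
  GRing.Lalgebra_isAlgebra.Build K (freealg K X) freealg_scalerAr.

End FreeAlg.

Section IdealQuotients.
Variables (K : fieldType) (T : algType K) (S : T -> Prop).

Definition ideal_gen (t : T) : Prop := exists a r b, S r /\ t = a * r * b.

(* T modulo the two-sided ideal generated by S. *)
Definition quota : Type := quotv ideal_gen.

HB.instance Definition _ := GRing.Lmodule.on quota.

Definition qone : quota := qpi ideal_gen 1.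
Definition qmul (x y : quota) : quota := qpi ideal_gen (qrepr x * qrepr y).

Lemma ideal_mull a u : lin_span ideal_gen u -> lin_span ideal_gen (a * u).
Proof.
elim=> {u} [|c x y [a1 [r [b1 [Sr ->]]]] _ IH]; first by rewrite mulr0; exact: Span0.
rewrite mulrDr -scalerAr; apply: SpanZD => //.
by exists (a * a1), r, b1; rewrite !mulrA.
Qed.

Lemma ideal_mulr a u : lin_span ideal_gen u -> lin_span ideal_gen (u * a).
Proof.
elim=> {u} [|c x y [a1 [r [b1 [Sr ->]]]] _ IH]; first by rewrite mul0r; exact: Span0.
rewrite mulrDl -scalerAl; apply: SpanZD => //.
by exists a1, r, (b1 * a); rewrite !mulrA.
Qed.

Lemma qpi_mul a b : qpi ideal_gen (a * b) = qmul (qpi ideal_gen a) (qpi ideal_gen b).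
Proof.
apply/qpi_eq; set a' := qrepr _; set b' := qrepr _.
have Ia : lin_span ideal_gen (a - a') by apply/qpi_eq; rewrite qreprK.
have Ib : lin_span ideal_gen (b - b') by apply/qpi_eq; rewrite qreprK.
have -> : a * b - a' * b' = 1 *: (a * (b - b')) + (a - a') * b'.
  by rewrite scale1r mulrBr mulrBl addrA subrK.
by apply: span_linear; [exact: ideal_mull | exact: ideal_mulr].
Qed.

Fact qmulA : associative qmul.
Proof.
move=> x y z; rewrite -[x]qreprK -[y]qreprK -[z]qreprK.
by rewrite -!qpi_mul mulrA.
Qed.
Fact qmul1 : left_id qone qmul.
Proof. by move=> x; rewrite -[x]qreprK -qpi_mul mul1r. Qed.
Fact qmulr1 : right_id qone qmul.
Proof. by move=> x; rewrite -[x]qreprK -qpi_mul mulr1. Qed.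
Fact qmulDl : left_distributive qmul +%R.
Proof.
move=> x y z; rewrite -[x]qreprK -[y]qreprK -[z]qreprK.
by rewrite -qpiD -!qpi_mul mulrDl -qpiD.
Qed.
Fact qmulDr : right_distributive qmul +%R.
Proof.
move=> x y z; rewrite -[x]qreprK -[y]qreprK -[z]qreprK.
by rewrite -qpiD -!qpi_mul mulrDr -qpiD.
Qed.

HB.instance Definition _ := GRing.Zmodule_isPzRing.Build quota
  qmulA qmul1 qmulr1 qmulDl qmulDr.

Lemma quota_scalerAr c (x y : quota) : x * (c *: y) = c *: (x * y).
Proof.
have piZ d (t : T) : d *: (qpi ideal_gen t : quota) = qpi ideal_gen (d *: t).
  exact: esym (qpiZ _ _ _).
rewrite -[x]qreprK -[y]qreprK piZ.
transitivity (qpi ideal_gen (qrepr x * (c *: qrepr y))).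
  exact: esym (qpi_mul _ _).
rewrite -scalerAr -piZ; congr (_ *: _); exact: qpi_mul.
Qed.

End IdealQuotients.

(* V ⊗ K[t, 1/t], as finitely supported families of coefficients in V indexed *)
(* by the exponent; lmon v n is v ⊗ t^n and f@_n is the coefficient of t^n.   *)
Definition laurent (K : fieldType) (V : lmodType K) : Type := {malg V[int]}.

Section Laurent.
Variables (K : fieldType) (V : lmodType K).

HB.instance Definition _ := GRing.Zmodule.on (laurent V).

Definition lmon (v : V) (n : int) : laurent V := << v *g n >>.

Definition lscale (c : K) (f : laurent V) : laurent V :=
  [malg n in msupp f => c *: f@_n].

Fact lscaleE c f n : (lscale c f)@_n = c *: f@_n.
Proof. by rewrite mcoeffE; case: msuppP; rewrite ?scaler0. Qed.
Fact lscaleA a b f : lscale a (lscale b f) = lscale (a * b) f.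
Proof. by apply/malgP => n; rewrite !lscaleE scalerA. Qed.
Fact lscale1 : left_id 1 lscale.
Proof. by move=> f; apply/malgP => n; rewrite lscaleE scale1r. Qed.
Fact lscaleDr : right_distributive lscale +%R.
Proof.
by move=> c f g; apply/malgP => n; rewrite !(lscaleE, mcoeffD) scalerDr.
Qed.
Fact lscaleDl f : {morph lscale^~ f : a b / a + b}.
Proof.
by move=> a b; apply/malgP => n; rewrite !(lscaleE, mcoeffD) scalerDl.
Qed.

HB.instance Definition _ := GRing.Zmodule_isLmodule.Build K (laurent V)
  lscaleA lscale1 lscaleDr lscaleDl.

Lemma laurentE (f : laurent V) : f = \sum_(n <- msupp f) lmon f@_n n.
Proof. exact: monalgE. Qed.

Lemma mcoeff_lin n : linear (fun f : laurent V => f@_n).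
Proof. by move=> c f g; rewrite mcoeffD; congr (_ + _); exact: lscaleE. Qed.

Lemma lmon_lin n : linear (lmon^~ n).
Proof.
move=> c u v; apply/malgP => k; rewrite mcoeff_lin !mcoeffU.
by case: eqP; rewrite ?mulr1n // !mulr0n scaler0 addr0.
Qed.

End Laurent.

Section LaurentSum.
Variables (K : fieldType) (V W : lmodType K) (F : V -> int -> W).
Hypothesis F_lin : forall n, linear (F^~ n).

Definition lsum (f : laurent V) : W := \sum_(n <- msupp f) F f@_n n.

Lemma lsumEw (d : {fset int}) (f : laurent V) :
  (msupp f `<=` d)%fset -> lsum f = \sum_(n <- d) F f@_n n.
Proof.
move=> le; rewrite /lsum; apply: big_fset_incl => [//|n _ /mcoeff_outdom ->].
exact: (lin0 (F_lin n)).
Qed.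

Lemma lsum_lin : linear lsum.
Proof.
move=> c f g; set d := (msupp f `|` msupp g)%fset.
have lf : (msupp f `<=` d)%fset by exact: fsubsetUl.
have lg : (msupp g `<=` d)%fset by exact: fsubsetUr.
have ld : (msupp (c *: f + g : laurent V) `<=` d)%fset.
  apply/fsubsetP => n; rewrite -mcoeff_neq0 mcoeff_lin inE -!mcoeff_neq0.
  apply: contraNT; rewrite negb_or !negbK => /andP[/eqP-> /eqP->].
  by rewrite scaler0 addr0.
rewrite (lsumEw lf) (lsumEw lg) (lsumEw ld) scaler_sumr -big_split /=.
by apply: eq_bigr => n _; rewrite mcoeff_lin F_lin.
Qed.

Lemma lsum_mon v n : lsum (lmon v n) = F v n.
Proof.
rewrite (@lsumEw [fset n]%fset); last by exact: msuppU_le.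
by rewrite big_seq_fset1 mcoeffUU.
Qed.

End LaurentSum.

Section Super.
Context {K : fieldType}.

(* A decomposition V = V_0 ⊕ V_1, given by the two homogeneous component      *)
(* projections; the parities 0 and 1 are the booleans false and true.         *)
Record superspace (V : lmodType K) := Superspace {
  hcomp : bool -> V -> V;
  hcomp_linear : forall p, linear (hcomp p);
  hcompK : forall p q v, hcomp p (hcomp q v) = if p == q then hcomp q v else 0;
  hcompD : forall v, v = hcomp false v + hcomp true v
}.

Definition homog (V : lmodType K) (sV : superspace V) (p : bool) (v : V) : Prop :=
  hcomp sV p v = v.

Definition even_op (V : lmodType K) (sV : superspace V) (f : V -> V) : Prop :=
  forall p v, homog sV p v -> homog sV p (f v).

Definition eps (p q : bool) : K := (-1) ^+ (p && q).

Definition bilin (U V W : lmodType K) (f : U -> V -> W) : Prop :=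
  (forall v, linear (f^~ v)) /\ (forall u, linear (f u)).

Definition parity_map (U V : lmodType K) (sU : superspace U)
    (sV : superspace V) (f : U -> V) : Prop :=
  forall p u, homog sU p u -> homog sV p (f u).

Definition parity_map2 (U V W : lmodType K) (sU : superspace U)
    (sV : superspace V) (sW : superspace W) (f : U -> V -> W) : Prop :=
  forall p q u v, homog sU p u -> homog sV q v -> homog sW (p (+) q) (f u v).

Record supercomm_algebra (A : algType K) := SupercommAlgebra {
  alg_super :> superspace A;
  alg_one_even : homog alg_super false 1;
  alg_mul_parity : parity_map2 alg_super alg_super alg_super *%R;
  alg_supercomm : forall p q a b, homog alg_super p a -> homog alg_super q b ->
    a * b = eps p q *: (b * a)
}.

Definition superderivation (A : algType K) (sA : superspace A) (s : bool)
    (D : A -> A) : Prop :=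
  [/\ linear D,
      forall p a, homog sA p a -> homog sA (s (+) p) (D a) &
      forall p a b, homog sA p a -> D (a * b) = D a * b + eps s p *: (a * D b)].

Record leibniz_bracket (V : lmodType K) (sV : superspace V)
    (br : V -> V -> V) : Prop := LeibnizBracket {
  br_bilin : bilin br;
  br_parity : parity_map2 sV sV sV br;
  br_leibniz : forall p q u v w, homog sV p u -> homog sV q v ->
    br u (br v w) = br (br u v) w + eps p q *: br v (br u w)
}.

(* va_act is a * v, va_anchor is pi, va_pair is <u,v>, va_der is ∂.           *)
Record vertex_algebroid (A : algType K) (sA : supercomm_algebra A)
    (B : lmodType K) := VertexAlgebroid {
  va_super :> superspace B;
  va_act : A -> B -> B;
  va_br : B -> B -> B;
  va_anchor : B -> A -> A;
  va_pair : B -> B -> A;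
  va_der : A -> B;
  va_act_bilin : bilin va_act;
  va_act_parity : parity_map2 sA va_super va_super va_act;
  va_act1 : forall v, va_act 1 v = v;
  va_br_leibniz : leibniz_bracket va_super va_br;
  va_anchor_bilin : bilin va_anchor;
  va_anchor_der : forall p u, homog va_super p u ->
    superderivation sA p (va_anchor u);
  va_anchor_br : forall p q u v a, homog va_super p u -> homog va_super q v ->
    va_anchor (va_br u v) a =
    va_anchor u (va_anchor v a) - eps p q *: va_anchor v (va_anchor u a);
  va_pair_bilin : bilin va_pair;
  va_pair_parity : parity_map2 va_super va_super sA va_pair;
  va_pair_sym : forall p q u v, homog va_super p u -> homog va_super q v ->
    va_pair u v = eps p q *: va_pair v u;
  va_der_linear : linear va_der;
  va_der_parity : parity_map sA va_super va_der;
  va_anchor_der0 : forall a a', va_anchor (va_der a) a' = 0;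
  va_act_act : forall p p' a a' v, homog sA p a -> homog sA p' a' ->
    va_act a (va_act a' v) - va_act (a * a') v =
    eps p p' *: va_act (va_anchor v a) (va_der a')
    + va_act (va_anchor v a') (va_der a);
  va_br_act : forall p q a u v, homog sA p a -> homog va_super q u ->
    va_br u (va_act a v) =
    va_act (va_anchor u a) v + eps q p *: va_act a (va_br u v);
  va_br_skew : forall p q u v, homog va_super p u -> homog va_super q v ->
    va_br u v + eps p q *: va_br v u = va_der (va_pair u v);
  va_anchor_act : forall a v a', va_anchor (va_act a v) a' = a * va_anchor v a';
  va_pair_act : forall p q r a u v,
    homog sA p a -> homog va_super q u -> homog va_super r v ->
    va_pair (va_act a u) v =
    a * va_pair u v - (eps p q * eps p r) *: va_anchor u (va_anchor v a);
  va_anchor_pair : forall p q v v1 v2, homog va_super p v -> homog va_super q v1 ->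
    va_anchor v (va_pair v1 v2) =
    va_pair (va_br v v1) v2 + eps p q *: va_pair v1 (va_br v v2);
  va_derM : forall p p' a a', homog sA p a -> homog sA p' a' ->
    va_der (a * a') = va_act a (va_der a') + eps p p' *: va_act a' (va_der a);
  va_br_der : forall v a, va_br v (va_der a) = va_der (va_anchor v a);
  va_pair_der : forall v a, va_pair v (va_der a) = va_anchor v a
}.

End Super.

Section Vertex.
Context {K : fieldType}.

(* The binomial coefficient m(m-1)...(m-i+1)/i! for an integer m. *)
Definition binz (m : int) (i : nat) : K :=
  (\prod_(j < i) (m - j%:Z)%:~R) / (i`!)%:R.

(* vmode u n is the mode u_n in Y(u,x) = \sum_n u_n x^(-n-1).  vborcherds is  *)
(* the Jacobi identity, read off as the coefficients of its monomials in      *)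
(* x0, x1, x2; by vtrunc both of its sums have finitely many nonzero terms,   *)
(* so all large enough partial sums are equal to the full ones.               *)
Record vertex_superalgebra (V : lmodType K) := VertexSuperalgebra {
  vsuper :> superspace V;
  vvac : V;
  vmode : V -> int -> V -> V;
  vvac_even : homog vsuper false vvac;
  vmode_bilin : forall n, bilin (fun u v => vmode u n v);
  vmode_parity : forall n,
    parity_map2 vsuper vsuper vsuper (fun u v => vmode u n v);
  vtrunc : forall u v, exists N : int, forall n : int, N <= n -> vmode u n v = 0;
  vvac_id : forall (n : int) v, vmode vvac n v = if n == -1 then v else 0;
  vcreation : forall v, vmode v (-1) vvac = v;
  vcreation0 : forall v (n : int), 0 <= n -> vmode v n vvac = 0;
  vborcherds : forall p q u v w (l m n : int), homog vsuper p u -> homog vsuper q v ->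
    exists N0 : nat, forall N : nat, (N0 <= N)%N ->
      \sum_(i < N)
        binz m i *: vmode (vmode u (l + i%:Z) v) (m + n - i%:Z) w =
      \sum_(i < N) ((-1) ^+ i * binz l i) *:
        (vmode u (m + l - i%:Z) (vmode v (n + i%:Z) w)
         - ((-1) ^ l * eps p q) *:
           vmode v (n + l - i%:Z) (vmode u (m + i%:Z) w))
}.

Definition vD (V : lmodType K) (Y : vertex_superalgebra V) (v : V) : V :=
  vmode Y v (-2) (vvac Y).

(* A Vir^+-module structure on V: L m is the operator L(m), and only the      *)
(* values L m with m >= -1 matter.  The central term (m^3-m)/12 of the        *)
(* Virasoro bracket is 0 when m, n >= -1 and m + n = 0.                       *)
Definition virp_module (V : lmodType K) (L : int -> V -> V) : Prop :=
  (forall m : int, -1 <= m -> linear (L m)) /\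
  (forall m n : int, -1 <= m -> -1 <= n -> forall v,
     L m (L n v) - L n (L m v) = (m - n)%:~R *: L (m + n) v).

(* For the pair L0, L1 of operators, the bracket relation of b = span{L_0,L_1}*)
(* is [L_0, L_1] = - L_1; weight means that L(0) is diagonalizable.           *)
Record weight_b_module (V : lmodType K) (L0 L1 : V -> V) : Prop :=
    WeightBModule {
  b_L0_linear : linear L0;
  b_L1_linear : linear L1;
  b_bracket : forall v, L0 (L1 v) - L1 (L0 v) = - L1 v;
  b_weight : forall v, lin_span (fun w => exists c : K, L0 w = c *: w) v
}.

(* [L(m), Y(u,x)] = \sum_(i < N) binom(m+1,i) x^(m+1-i) Y(L(i-1)u,x),         *)
(* coefficient of x^(-n-1).                                                   *)
Definition comm_formula (V : lmodType K) (Y : vertex_superalgebra V)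
    (L : int -> V -> V) (m : int) (N : nat) (u : V) : Prop :=
  forall n v, L m (vmode Y u n v) - vmode Y u n (L m v) =
    \sum_(i < N) binz (m + 1) i *:
      vmode Y (L (i%:Z - 1) u) (m + 1 - i%:Z + n) v.

Definition direct_sum (V : lmodType K) (W : int -> V -> Prop) : Prop :=
  (forall v, lin_span (fun w => exists n, W n w) v) /\
  (forall (s : seq int) (w : int -> V), uniq s -> (forall n, W n (w n)) ->
     \sum_(n <- s) w n = 0 -> forall n, n \in s -> w n = 0).

Definition Lweight (V : lmodType K) (L : int -> V -> V) (n : int) (v : V) :=
  L 0 v = n%:~R *: v.

(* As binom(m+1,i) = 0 for i > m+1 >= 0, the sum over all i >= 0 in the last  *)
(* condition has at most the m + 2 terms 0 <= i <= m+1.                       *)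
Record semi_conformal (V : lmodType K) (Y : vertex_superalgebra V)
    (L : int -> V -> V) : Prop := SemiConformal {
  sc_virp : virp_module L;
  sc_grading : direct_sum (Lweight L);
  sc_bounded : exists N : int, forall n : int, N <= n ->
    forall v, Lweight L (- n) v -> v = 0;
  sc_D : forall v, L (-1) v = vD Y v;
  sc_comm : forall (m : int) u, -1 <= m -> comm_formula Y L m (absz (m + 2)) u
}.

End Vertex.

Section AssociatedVertex.
Variables (K : fieldType) (A : algType K) (sA : supercomm_algebra A).
Variables (B : lmodType K) (sB : vertex_algebroid sA B).

Local Notation AB := (A * B)%type.
Local Notation act := (va_act sB).
Local Notation br := (va_br sB).
Local Notation anchor := (va_anchor sB).
Local Notation pair := (va_pair sB).
Local Notation der := (va_der sB).

Definition ABcomp (p : bool) (u : AB) : AB := (hcomp sA p u.1, hcomp sB p u.2).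

Fact ABcomp_linear p : linear (ABcomp p).
Proof.
by move=> c [a b] [a' b']; rewrite /ABcomp /= !hcomp_linear.
Qed.
Fact ABcompK p q u :
  ABcomp p (ABcomp q u) = if p == q then ABcomp q u else 0.
Proof. by rewrite /ABcomp /= !hcompK; case: ifP. Qed.
Fact ABcompD u : u = ABcomp false u + ABcomp true u.
Proof.
by case: u => a b; rewrite /ABcomp {1}(hcompD sA a) {1}(hcompD sB b).
Qed.

Definition ABsuper : superspace AB := Superspace ABcomp_linear ABcompK ABcompD.

(* u_0 v and u_1 v; a_0 b = - eps_{b,a} pi(b)(a) is extended bilinearly to    *)
(* non-homogeneous a and b.                                                   *)
Definition a0b (a : A) (b : B) : A :=
  - \sum_(p : bool) \sum_(q : bool)
      eps q p *: anchor (hcomp sB q b) (hcomp sA p a).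

Definition prod0 (u v : AB) : AB := (anchor u.2 v.1 + a0b u.1 v.2, br u.2 v.2).
Definition prod1 (u v : AB) : AB := (pair u.2 v.2, 0).

Definition ABact (a : A) (u : AB) : AB := (a * u.1, act a u.2).

Definition inA (a : A) : AB := (a, 0).
Definition inB (b : B) : AB := (0, b).

(* The bracket of L(A ⊕ B).  The term with prod1 only involves the components *)
(* in B, and prod0 (inA a) (inA a') = 0.                                      *)
Definition loop_br (f g : laurent AB) : laurent AB :=
  \sum_(m <- msupp f) \sum_(n <- msupp g)
    (lmon (prod0 f@_m g@_n) (m + n)
     + lmon (m%:~R *: prod1 f@_m g@_n) (m + n - 1)).

Definition loop_hom (p : bool) (f : laurent AB) : Prop :=
  forall n, homog ABsuper p f@_n.

Definition dhat (f : laurent A) : laurent AB :=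
  \sum_(n <- msupp f)
    (lmon (inB (der f@_n)) n + lmon (n%:~R *: inA f@_n) (n - 1)).

Definition dhat_image (x : laurent AB) : Prop := exists f, x = dhat f.

Definition Lie : Type := quotv dhat_image.
HB.instance Definition _ := GRing.Lmodule.on Lie.

Definition Lie_br (x y : Lie) : Lie := qpi dhat_image (loop_br (qrepr x) (qrepr y)).

Lemma a0b_bilin : bilin a0b.
Proof.
have [h1 h2] := va_anchor_bilin sB.
split=> [b c a a'|a c b b']; rewrite /a0b scalerN -opprD; congr (- _).
  rewrite scaler_sumr -big_split; apply: eq_bigr => p _ /=.
  rewrite scaler_sumr -big_split; apply: eq_bigr => q _ /=.
  by rewrite hcomp_linear h2 scalerDr !scalerA mulrC.
rewrite scaler_sumr -big_split; apply: eq_bigr => p _ /=.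
rewrite scaler_sumr -big_split; apply: eq_bigr => q _ /=.
by rewrite hcomp_linear h1 scalerDr !scalerA mulrC.
Qed.

Lemma prod0_bilin : bilin prod0.
Proof.
have [h1 h2] := va_anchor_bilin sB; have [k1 k2] := a0b_bilin.
have [j1 j2] := br_bilin (va_br_leibniz sB).
split=> [v c u u'|u c v v']; congr (_, _) => /=.
- by rewrite h1 k1 scalerDr addrACA.
- by rewrite j1.
- by rewrite h2 k2 scalerDr addrACA.
by rewrite j2.
Qed.

Lemma prod1_bilin : bilin prod1.
Proof.
have [h1 h2] := va_pair_bilin sB.
by split=> [v c u u'|u c v v']; congr (_, _) => /=;
  rewrite ?h1 ?h2 // scaler0 addr0.
Qed.

Definition mon_br (u : AB) (m : int) (v : AB) (n : int) : laurent AB :=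
  lmon (prod0 u v) (m + n) + lmon (m%:~R *: prod1 u v) (m + n - 1).

Lemma mon_br_linl m v n : linear (fun u => mon_br u m v n).
Proof.
move=> c u u'; rewrite /mon_br prod0_bilin.1 prod1_bilin.1 [_%:~R *: _]scalerDr.
by rewrite scalerA mulrC -scalerA !lmon_lin scalerDr addrACA.
Qed.

Lemma mon_br_linr u m n : linear (fun v => mon_br u m v n).
Proof.
move=> c v v'; rewrite /mon_br prod0_bilin.2 prod1_bilin.2 [_%:~R *: _]scalerDr.
by rewrite scalerA mulrC -scalerA !lmon_lin scalerDr addrACA.
Qed.

Lemma loop_br_linl g : linear (loop_br^~ g).
Proof.
apply: (@lsum_lin _ _ _ (fun u m => lsum (mon_br u m) g)) => m c u u'.
by rewrite /lsum scaler_sumr -big_split; apply: eq_bigr => n _; rewrite mon_br_linl.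
Qed.

Lemma loop_br_linr f : linear (loop_br f).
Proof.
move=> c g g'; rewrite /loop_br scaler_sumr -big_split; apply: eq_bigr => m _.
exact: (lsum_lin (mon_br_linr f@_m m)).
Qed.

Lemma loop_br_mon u m v n : loop_br (lmon u m) (lmon v n) = mon_br u m v n.
Proof.
transitivity (lsum (mon_br u m) (lmon v n)); last first.
  by apply: lsum_mon => k; exact: mon_br_linr.
apply: (@lsum_mon _ _ _ (fun u m => lsum (mon_br u m) (lmon v n))) => k c x y.
by rewrite /lsum scaler_sumr -big_split; apply: eq_bigr => i _; rewrite mon_br_linl.
Qed.

Lemma dhat_mon_lin n : linear (fun a : A =>
  lmon (inB (der a)) n + lmon (n%:~R *: inA a) (n - 1)).
Proof.
move=> c a a'; rewrite va_der_linear.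
have -> : inB (c *: der a + der a') = c *: inB (der a) + inB (der a').
  by congr (_, _); rewrite /= scaler0 addr0.
have -> : inA (c *: a + a') = c *: inA a + inA a'.
  by congr (_, _); rewrite /= scaler0 addr0.
rewrite [_%:~R *: _]scalerDr scalerA mulrC -scalerA !lmon_lin scalerDr.
by rewrite addrACA.
Qed.

Lemma dhat_lin : linear dhat.
Proof. exact: lsum_lin dhat_mon_lin. Qed.

Lemma dhat_mon a n : dhat (lmon a n) =
  lmon (inB (der a)) n + lmon (n%:~R *: inA a) (n - 1).
Proof. exact: (lsum_mon dhat_mon_lin). Qed.

Lemma hcomp_homog (V : lmodType K) (sV : superspace V) p v :
  homog sV p (hcomp sV p v).
Proof. by rewrite /homog hcompK eqxx. Qed.

Lemma hcomp_other (V : lmodType K) (sV : superspace V) p q v :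
  homog sV p v -> hcomp sV q v = if q == p then v else 0.
Proof. by move=> h; rewrite -{1}h hcompK h; case: eqP. Qed.

Lemma hcomp_der q a : hcomp sB q (der a) = der (hcomp sA q a).
Proof.
have H p : homog sB p (der (hcomp sA p a)).
  by apply: va_der_parity; exact: hcomp_homog.
rewrite {1}(hcompD sA a) (linD (va_der_linear sB)).
rewrite (linD (hcomp_linear sB q)) !(hcomp_other q (H _)).
by case: q; rewrite /= ?addr0 ?add0r.
Qed.

Lemma a0bE p q a b : homog sA p a -> homog sB q b ->
  a0b a b = - (eps q p *: anchor b a).
Proof.
move=> ha hb; rewrite /a0b; congr (- _).
have [h1 h2] := va_anchor_bilin sB.
rewrite (bigD1 p) //= (bigD1 q) //= ha hb big1 ?addr0; last first.
  by move=> q' nq; rewrite -hb hcompK (negbTE nq) (lin0 (h1 _)) scaler0.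
rewrite big1 ?addr0 // => p' np; rewrite big1 // => q' _.
by rewrite -ha hcompK (negbTE np) (lin0 (h2 _)) scaler0.
Qed.

Lemma pair_der a b : pair (der a) b = - a0b a b.
Proof.
have [h1 h2] := va_pair_bilin sB; have [k1 k2] := a0b_bilin.
have H p q : pair (der (hcomp sA p a)) (hcomp sB q b) =
    - a0b (hcomp sA p a) (hcomp sB q b).
  have ha := hcomp_homog sA p a; have hb := hcomp_homog sB q b.
  rewrite (a0bE ha hb) opprK (va_pair_sym (va_der_parity sB ha) hb).
  by rewrite va_pair_der /eps andbC.
rewrite (hcompD sA a) (hcompD sB b) (linD (va_der_linear sB)).
rewrite !(linD (h1 _)) !(linD (h2 _)) !(linD (k1 _)) !(linD (k2 _)).
by rewrite !H !opprD.
Qed.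

Lemma br_der0 a b : br (der a) b = 0.
Proof.
have [h1 h2] := br_bilin (va_br_leibniz sB).
have H p q : br (der (hcomp sA p a)) (hcomp sB q b) = 0.
  have ha := hcomp_homog sA p a; have hb := hcomp_homog sB q b.
  have := va_br_skew (va_der_parity sB ha) hb.
  rewrite (va_pair_sym (va_der_parity sB ha) hb) va_pair_der va_br_der.
  rewrite (linZ (va_der_linear sB)).
  by move/(canRL (addrK _)); rewrite subrr.
rewrite (hcompD sA a) (hcompD sB b) (linD (va_der_linear sB)).
by rewrite !(linD (h1 _)) !(linD (h2 _)) !H !addr0.
Qed.

Lemma loop_br_dhatl f g : loop_br (dhat f) g = 0.
Proof.
rewrite (laurentE f) (lin_sum dhat_lin) (lin_sum (loop_br_linl g)).
rewrite big1_seq // => m _.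
rewrite (laurentE g) (lin_sum (loop_br_linr _)) big1_seq // => n _.
move: (f@_m) (g@_n) => a [a' b].
rewrite dhat_mon (linD (loop_br_linl _)) !loop_br_mon /mon_br.
have [j1 j2] := prod0_bilin; have [k1 k2] := prod1_bilin.
rewrite (linZ (j1 _)) (linZ (k1 _)).
have -> : prod0 (inB (der a)) (a', b) = 0.
  by rewrite /prod0 /= va_anchor_der0 br_der0 (lin0 (a0b_bilin.1 b)) addr0.
have -> : prod1 (inA a) (a', b) = 0.
  by rewrite /prod1 /= (lin0 ((va_pair_bilin sB).1 b)).
have -> : prod1 (inB (der a)) (a', b) = - prod0 (inA a) (a', b).
  rewrite /prod1 /prod0 /= pair_der (lin0 ((va_anchor_bilin sB).1 _)) add0r.
  rewrite (lin0 ((br_bilin (va_br_leibniz sB)).1 _)).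
  by transitivity ((- a0b a b, - 0) : AB); first by rewrite oppr0.
have -> : m - 1 + n = m + n - 1 by rewrite addrAC.
rewrite !scaler0 !(lin0 (lmon_lin _)) add0r addr0.
by rewrite -(linD (lmon_lin _)) scalerN addNr (lin0 (lmon_lin _)).
Qed.

Lemma loop_br_mon_dhat a' a b n m :
  loop_br (lmon (a', b) n) (dhat (lmon a m)) = dhat (lmon (anchor b a) (n + m)).
Proof.
have [h1 h2] := va_anchor_bilin sB; have [k1 k2] := a0b_bilin.
have [j1 j2] := prod0_bilin; have [i1 i2] := prod1_bilin.
rewrite !dhat_mon (linD (loop_br_linr _)) !loop_br_mon /mon_br.
rewrite (linZ (j2 _)) (linZ (i2 _)).
have -> : prod0 (a', b) (inB (der a)) = inB (der (anchor b a)).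
  rewrite /prod0 /= (lin0 (h2 _)) va_br_der add0r /a0b big1 ?oppr0 // => p _.
  by rewrite big1 // => q _; rewrite hcomp_der va_anchor_der0 scaler0.
have -> : prod1 (a', b) (inB (der a)) = inA (anchor b a).
  by rewrite /prod1 /= va_pair_der.
have -> : prod0 (a', b) (inA a) = inA (anchor b a).
  rewrite /prod0 /= (lin0 (k2 _)) addr0.
  by rewrite (lin0 ((br_bilin (va_br_leibniz sB)).2 _)).
have -> : prod1 (a', b) (inA a) = 0.
  by rewrite /prod1 /= (lin0 ((va_pair_bilin sB).2 _)).
have -> : n + (m - 1) = n + m - 1 by rewrite addrA.
rewrite !scaler0 (lin0 (lmon_lin _)) addr0 -addrA -(linD (lmon_lin _)).
by rewrite -scalerDl -intrD.
Qed.

Lemma loop_br_dhatr g f : lin_span dhat_image (loop_br g (dhat f)).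
Proof.
rewrite (laurentE g) (lin_sum (loop_br_linl _)); apply: span_sum => n.
rewrite (laurentE f) (lin_sum dhat_lin) (lin_sum (loop_br_linr _)).
apply: span_sum => m; case: (g@_n) => a' b; rewrite loop_br_mon_dhat.
by apply: span_gen; exists (lmon (anchor b f@_m) (n + m)).
Qed.

Lemma Lie_br_pi f g :
  Lie_br (qpi dhat_image f) (qpi dhat_image g) = qpi dhat_image (loop_br f g).
Proof.
apply/esym/qpi_eq; set f' := qrepr _; set g' := qrepr _.
have Hf : lin_span dhat_image (f - f') by apply/qpi_eq; rewrite qreprK.
have Hg : lin_span dhat_image (g - g') by apply/qpi_eq; rewrite qreprK.
have -> : loop_br f g - loop_br f' g' =
    1 *: loop_br (f - f') g + loop_br f' (g - g').
  rewrite scale1r (linB (loop_br_linl _)) (linB (loop_br_linr _)).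
  by rewrite addrA subrK.
apply: span_linear.
  apply: (span_map (loop_br_linl g)) Hf => _ [h ->].
  by rewrite loop_br_dhatl; exact: Span0.
by apply: (span_map (loop_br_linr f')) Hg => _ [h ->]; exact: loop_br_dhatr.
Qed.

Definition Lie_hom (p : bool) (x : Lie) : Prop :=
  exists f, loop_hom p f /\ x = qpi dhat_image f.

Definition Lie_mode (u : AB) (n : int) : Lie := qpi dhat_image (lmon u n).

Definition Lie_ge0 : Lie -> Prop :=
  lin_span (fun x => exists u (n : int), 0 <= n /\ x = Lie_mode u n).

Inductive env_rel : freealg K Lie -> Prop :=
| EnvLinear c x y :
    env_rel (fgen K (c *: x + y) - (c *: fgen K x + fgen K y))
| EnvBracket p q x y : Lie_hom p x -> Lie_hom q y ->
    env_rel (fgen K x * fgen K y - eps p q *: (fgen K y * fgen K x)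
             - fgen K (Lie_br x y)).

Definition Env : Type := quota env_rel.
HB.instance Definition _ := GRing.Lmodule.on Env.
HB.instance Definition _ := GRing.PzRing.on Env.

Definition env_in (x : Lie) : Env := qpi (ideal_gen env_rel) (fgen K x).

(* U(Lie) ⊗_{U(Lie_ge0)} K with K the trivial module: the relations           *)
(* x y ⊗ 1 = x ⊗ y 1 = 0 for y in Lie_ge0.                                    *)
Definition induced_rel (z : Env) : Prop :=
  exists (x : Env) y, Lie_ge0 y /\ z = x * env_in y.

Definition VL : Type := quotv induced_rel.
HB.instance Definition _ := GRing.Lmodule.on VL.

Definition VLact (x : Env) (v : VL) : VL := qpi induced_rel (x * qrepr v).

Lemma VLact_pi x y : VLact x (qpi induced_rel y) = qpi induced_rel (x * y).
Proof.
apply/esym/qpi_eq; rewrite -mulrBr; set y' := qrepr _.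
have: lin_span induced_rel (y - y') by apply/qpi_eq; rewrite qreprK.
elim=> [|c u v [x' [z [hz ->]]] _ IH]; first by rewrite mulr0; exact: Span0.
rewrite mulrDr quota_scalerAr; apply: SpanZD IH.
by exists (x * x'), z; rewrite mulrA.
Qed.

Definition VLop (u : AB) (n : int) (v : VL) : VL := VLact (env_in (Lie_mode u n)) v.
Definition VLvac : VL := qpi induced_rel 1.
Definition VLin (u : AB) : VL := VLop u (-1) VLvac.

(* The vertex superalgebra structure on V_L with vacuum 1, such that the      *)
(* inclusion of A ⊕ B is even and Y(u,x) = \sum_n u(n) x^(-n-1) for u in      *)
(* A ⊕ B.                                                                     *)
Record VL_structure (Y : vertex_superalgebra VL) : Prop := VLStructure {
  VL_vac : vvac Y = VLvac;
  VL_parity : parity_map ABsuper Y VLin;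
  VL_mode : forall u n v, vmode Y (VLin u) n v = VLop u n v
}.

(* Words u1(n1) ... uk(nk) 1 of degree d, where deg a(n) = - n - 1 and        *)
(* deg b(n) = - n.                                                            *)
Inductive VLword : int -> VL -> Prop :=
| WordVac : VLword 0 VLvac
| WordA a n d v : VLword d v -> VLword (- n - 1 + d) (VLop (inA a) n v)
| WordB b n d v : VLword d v -> VLword (- n + d) (VLop (inB b) n v).

Definition VLdeg (d : int) : VL -> Prop := lin_span (VLword d).

Section QuotientVB.
Variable (Y : vertex_superalgebra VL).

Inductive Egen : VL -> Prop :=
| EgenOne : Egen (VLin (inA 1) - VLvac)
| EgenA a a' : Egen (VLop (inA a) (-1) (VLin (inA a')) - VLin (inA (a * a')))
| EgenB a b : Egen (VLop (inA a) (-1) (VLin (inB b)) - VLin (inB (act a b))).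

Definition IB_gen (v : VL) : Prop :=
  exists x k e, lin_span Egen e /\ v = VLact x (iter k (vD Y) e).

(* V_L / I_B, where I_B = U(Lie) K[D] E is the span of IB_gen. *)
Definition VB : Type := quotv IB_gen.
HB.instance Definition _ := GRing.Lmodule.on VB.

Definition VBpi (v : VL) : VB := qpi IB_gen v.
Definition VBin (u : AB) : VB := VBpi (VLin u).
Definition VBdeg (d : int) (v : VB) : Prop := exists w, VLdeg d w /\ v = VBpi w.

Record VB_structure (Z : vertex_superalgebra VB) : Prop := VBStructure {
  VB_vac : vvac Z = VBpi (vvac Y);
  VB_parity : parity_map Y Z VBpi;
  VB_mode : forall u n v, vmode Z (VBpi u) n (VBpi v) = VBpi (vmode Y u n v)
}.

(* u |-> u(-1) 1 identifies A with (V_B)_(0) and B with (V_B)_(1). *)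
Definition VB_low_degrees : Prop :=
  [/\ injective (VBin \o inA),
      forall v, VBdeg 0 v <-> exists a, v = VBin (inA a),
      injective (VBin \o inB) &
      forall v, VBdeg 1 v <-> exists b, v = VBin (inB b)].

Record extending_virp (Z : vertex_superalgebra VB) (L0 L1 : AB -> AB)
    (L : int -> VB -> VB) : Prop := ExtendingVirp {
  ext_virp : virp_module L;
  ext_L0 : forall u, L 0 (VBin u) = VBin (L0 u);
  ext_L1 : forall u, L 1 (VBin u) = VBin (L1 u);
  ext_D : forall v, L (-1) v = vD Z v;
  ext_comm : forall (m : int) u, -1 <= m -> comm_formula Z L m 3 (VBin u)
}.

End QuotientVB.
End AssociatedVertex.

(* Main.v *)
(* Write L(1)b = f(b) for b in B.  On the loop algebra the commutation formula  *)
(* forces ad L(m) to be                                                         *)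
(*   d_m (a t^n) = -(m+n+1) a t^(m+n),                                          *)
(*   d_m (b t^n) = -n b t^(m+n) + m(m+1)/2 f(b) t^(m+n-1).                      *)
(* The hypotheses on f make d_m an even derivation preserving the image of the  *)
(* total derivative, hence inducing a derivation of Lie; for                    *)
(* m >= -1 it preserves Lie^(>=0), so it acts on the induced module V_L by      *)
(* L(m) 1 = 0, L(m) x v = d_m(x) v + x L(m) v.  There L(-1) = D, the Virasoro   *)
(* relations hold, and L(m) E is contained in E for m >= 0 (for m = 1 this is   *)
(* the formula for f(ab)), so L(m) preserves I_B = U(Lie) C[D] E by             *)
(* [L(m), D] = (m+1) L(m-1).  The commutation formula spreads from generators   *)
(* to all of V_B by bracketing the Jacobi identity with L(m).                   *)
(* For uniqueness, L'(m) 1 vanishes for m >= 2 since it has weight -m < 0, and  *)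
(* for m = 0, 1 since 1 is the image of the identity of A.                      *)
Require Import Defs.
From mathcomp Require Import all_boot all_order all_algebra.
From mathcomp Require Import finmap monalg complex boolp reals.
From mathcomp Require Import ring zify.

Set Implicit Arguments.
Unset Strict Implicit.
Unset Printing Implicit Defensive.

Import Order.TTheory GRing.Theory Num.Theory.
Local Open Scope ring_scope.

(** * Linear predicates and maps *)

(** The operators are built on V_L, where a derivation of the Lie superalgebra is enough, and are
    then pushed down to V_B. Weights leave L(1) a single datum, the map f = [L1BA] from B to A
    ([L1_inB], [L1_inA]), and each hypothesis answers one need: f ∂ = 0 lets d_m descend to [Lie]
    ([loop_der_dhat]), compatibility with the bracket of B makes d_m a derivation
    ([loop_der_br_mon]), evenness makes it respect parities ([loop_der_hom]), and the rule for f(ab)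
    makes E stable ([virasoro_Egen]).

    [VL_derivation] turns d_m into an operator T_m on V_L. The Virasoro brackets
    ([VL_virasoro_bracket]) and T_(-1) = D ([VL_translation]) are checked on the vacuum and carried
    along words, because both sides have the same commutators with the modes of A and B. By
    [IB_stable] the T_m act on V_B.

    On V_B the formula for [L(m), Y(u,x)] is first known for generators u; [comm_formula_nat_vmode]
    passes it to the products u_l v. On generators it also determines L(m) from its value on the
    vacuum ([gext_unique]), so that uniqueness amounts to L'(m) 1 = 0 ([extending_virp_vac]). Words
    in negative modes span V_L ([negword_span]), hence L(0) is diagonalizable with nonnegative
    integer weights; this gives the grading, its lower bound, and the vanishing of L'(m) 1 for m >=
    2. *)

Section LinearPredicates.
Variable K : fieldType.

(** The condition under which a property can be proved by induction over spans, homogeneous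
    components, quotients or words; stated for arbitrary propositions so that one principle serves
    all of these. *)
Definition lin_closed (V : lmodType K) (P : V -> Prop) : Prop :=
  P 0 /\ forall c u v, P u -> P v -> P (c *: u + v).

Lemma lin_closed_sum (V : lmodType K) (P : V -> Prop) (I : Type) (r : seq I)
    (F : I -> V) :
  lin_closed P -> (forall i, P (F i)) -> P (\sum_(i <- r) F i).
Proof.
move=> [P0 PZD] h; elim/big_ind: _ => [||//]; first exact: P0.
by move=> x y Px Py; rewrite -[x]scale1r; exact: PZD.
Qed.

Lemma lin_closedZ (V : lmodType K) (P : V -> Prop) c u :
  lin_closed P -> P u -> P (c *: u).
Proof. by move=> [P0 PZD] Pu; rewrite -[_ *: _]addr0; apply: PZD. Qed.

Lemma lin_closedD (V : lmodType K) (P : V -> Prop) u v :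
  lin_closed P -> P u -> P v -> P (u + v).
Proof. by move=> [_ PZD] Pu Pv; rewrite -[u]scale1r; apply: PZD. Qed.

Lemma lin_closedB (V : lmodType K) (P : V -> Prop) u v :
  lin_closed P -> P u -> P v -> P (u - v).
Proof. by move=> [_ PZD] Pu Pv; rewrite addrC -scaleN1r; apply: PZD. Qed.

Lemma lin_span_closed (V : lmodType K) (S : V -> Prop) : lin_closed (lin_span S).
Proof. by split=> [|c u v]; [exact: Span0 | exact: span_linear]. Qed.

Lemma lin_span_ind (V : lmodType K) (S P : V -> Prop) :
  lin_closed P -> (forall u, S u -> P u) -> forall v, lin_span S v -> P v.
Proof.
by move=> [P0 PZD] SP v; elim=> // c u w Su _; apply: PZD; exact: SP.
Qed.

Lemma lin_closed_preim (V W : lmodType K) (f : V -> W) (P : W -> Prop) :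
  linear f -> lin_closed P -> lin_closed (fun v => P (f v)).
Proof.
by move=> f_lin [P0 PZD]; split=> [|c u v Pu Pv]; rewrite ?(lin0 f_lin) ?f_lin //; apply: PZD.
Qed.

Lemma lin_closed_and (V : lmodType K) (P Q : V -> Prop) :
  lin_closed P -> lin_closed Q -> lin_closed (fun v => P v /\ Q v).
Proof. by move=> [P0 PZD] [Q0 QZD]; split=> // c u v [? ?] [? ?]; split; auto. Qed.

Lemma lin_closed_eq (V W : lmodType K) (f g : V -> W) :
  linear f -> linear g -> lin_closed (fun v => f v = g v).
Proof.
move=> fl gl; split=> [|c u v hu hv]; first by rewrite (lin0 fl) (lin0 gl).
by rewrite fl gl hu hv.
Qed.

Lemma lin_closed_ker (V W : lmodType K) (f : V -> W) :
  linear f -> lin_closed (fun v => f v = 0).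
Proof.
move=> fl; split=> [|c u v hu hv]; first exact: lin0.
by rewrite fl hu hv scaler0 addr0.
Qed.

Lemma linear_id (V : lmodType K) : linear (fun v : V => v).
Proof. by []. Qed.

Lemma linear_fst (V W : lmodType K) : linear (fun w : V * W => w.1).
Proof. by []. Qed.

Lemma linear_snd (V W : lmodType K) : linear (fun w : V * W => w.2).
Proof. by []. Qed.

Lemma linear_comp (U V W : lmodType K) (f : V -> W) (g : U -> V) :
  linear f -> linear g -> linear (fun v => f (g v)).
Proof. by move=> fl gl c u v; rewrite gl fl. Qed.

Lemma linear_add (V W : lmodType K) (f g : V -> W) :
  linear f -> linear g -> linear (fun v => f v + g v).
Proof. by move=> fl gl c u v; rewrite fl gl scalerDr addrACA. Qed.

Lemma linear_scale (V W : lmodType K) (f : V -> W) a :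
  linear f -> linear (fun v => a *: f v).
Proof.
by move=> fl c u v; rewrite fl scalerDr !scalerA mulrC.
Qed.

Lemma linear_sub (V W : lmodType K) (f g : V -> W) :
  linear f -> linear g -> linear (fun v => f v - g v).
Proof. by move=> fl gl c u v; rewrite fl gl scalerBr opprD addrACA. Qed.

Lemma linear_bigsum (V W : lmodType K) (I : Type) (r : seq I) (F : I -> V -> W) :
  (forall i, linear (F i)) -> linear (fun v => \sum_(i <- r) F i v).
Proof.
move=> Fl c u v; rewrite scaler_sumr -big_split; apply: eq_bigr => i _.
exact: Fl.
Qed.

End LinearPredicates.

(** * The enveloping algebra and the induced module *)

Section FreeAlgebra.
Variables (K : fieldType) (X : choiceType).
Implicit Types (s t : freealg K X).

Lemma fgenM x (k : {fmonom X}) :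
  (fgen K x * << k >> : freealg K X) = << fmmul (fmu x) k >>.
Proof.
rewrite [LHS](@malgMEw _ _ [fset fmu x]%fset [fset k]%fset) ?msuppU_le //.
by rewrite !big_seq_fset1 !mcoeffUU mulr1.
Qed.

Lemma freealg_mon_ind (P : freealg K X -> Prop) :
  lin_closed P -> (forall k, P << k >>) -> forall t, P t.
Proof.
move=> Pl PU t; rewrite [t]monalgE; apply: lin_closed_sum => // k.
have -> : << t@_k *g k >> = t@_k *: (<< k >> : freealg K X).
  by apply/malgP => j; rewrite mcoeffZ !mcoeffU; case: eqP; rewrite ?mulr1 ?mulr0.
exact: lin_closedZ.
Qed.

Lemma freealg_ind (P : freealg K X -> Prop) :
  lin_closed P -> P 1 -> (forall x t, P t -> P (fgen K x * t)) -> forall t, P t.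
Proof.
move=> Pl P1 PM; apply: freealg_mon_ind => // -[k].
elim: k => [|x k IHk]; first by rewrite -fmoneE.
rewrite -[x :: k]/([:: x] ++ k) -(fmmulE (FMonom [:: x]) (FMonom k)) -fmuE -fgenM.
exact: PM.
Qed.

Section Evaluation.
Variables (W : lmodType K) (rho : X -> W -> W).
Hypothesis rho_lin : forall x, linear (rho x).

(** The action of the free algebra on W extending [rho]; the leftmost letter of a word acts last. *)
Definition freealg_eval t (w : W) : W :=
  \sum_(k <- msupp t) t@_k *: foldr rho w (k : seq X).

Lemma freealg_evalEw (d : {fset {fmonom X}}) t w : (msupp t `<=` d)%fset ->
  freealg_eval t w = \sum_(k <- d) t@_k *: foldr rho w (k : seq X).
Proof.
move=> le; apply: big_fset_incl => [//|k _ /mcoeff_outdom ->].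
by rewrite scale0r.
Qed.

Lemma freealg_eval_linl w : linear (freealg_eval^~ w).
Proof.
move=> c f g; set d := (msupp f `|` msupp g)%fset.
rewrite (@freealg_evalEw d f) ?fsubsetUl // (@freealg_evalEw d g) ?fsubsetUr //.
rewrite (@freealg_evalEw d); last first.
  apply: fsubset_trans (msuppD_le _ _) _; apply: fsetUSS => //; exact: msuppZ_le.
rewrite scaler_sumr -big_split /=; apply: eq_bigr => k _.
by rewrite mcoeffD mcoeffZ scalerDl scalerA.
Qed.

Lemma freealg_eval_linr t : linear (freealg_eval t).
Proof.
apply: linear_bigsum => k; apply: linear_scale.
by elim: (k : seq X) => [//|x s IHs c u v] /=; rewrite IHs rho_lin.
Qed.

Lemma freealg_eval_mon k w : freealg_eval << k >> w = foldr rho w (k : seq X).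
Proof.
rewrite (@freealg_evalEw [fset k]%fset) ?msuppU_le //.
by rewrite big_seq_fset1 mcoeffUU scale1r.
Qed.

Lemma freealg_eval1 w : freealg_eval 1 w = w.
Proof. by rewrite (freealg_eval_mon (fmone X)) fmoneE. Qed.

Lemma freealg_eval_genM x t w : freealg_eval (fgen K x * t) w = rho x (freealg_eval t w).
Proof.
move: t; apply: freealg_mon_ind => [|k].
  apply: lin_closed_eq; last exact: linear_comp (rho_lin x) (freealg_eval_linl w).
  by apply: linear_comp (freealg_eval_linl w) _ => c u v; rewrite mulrDr scalerAr.
by rewrite fgenM !freealg_eval_mon fmmulE fmuE.
Qed.

Lemma freealg_evalM s t w :
  freealg_eval (s * t) w = freealg_eval s (freealg_eval t w).
Proof.
move: s; apply: freealg_ind => [||x s IH].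
- apply: lin_closed_eq; last exact: freealg_eval_linl.
  apply: linear_comp (freealg_eval_linl w) _ => c u v.
  by rewrite mulrDl scalerAl.
- by rewrite mul1r freealg_eval1.
by rewrite -mulrA !freealg_eval_genM IH.
Qed.

Lemma freealg_eval_gen x w : freealg_eval (fgen K x) w = rho x w.
Proof. by rewrite -[fgen K x]mulr1 freealg_eval_genM freealg_eval1. Qed.

Lemma freealg_eval_linear_rel c x y z w :
  rho z w = c *: rho x w + rho y w ->
  freealg_eval (fgen K z - (c *: fgen K x + fgen K y)) w = 0.
Proof.
move=> E; rewrite (linB (freealg_eval_linl w)) (freealg_eval_linl w c (fgen K x)).
by rewrite !freealg_eval_gen E subrr.
Qed.

Lemma freealg_eval_br_rel c x y z w :
  rho x (rho y w) = c *: rho y (rho x w) + rho z w ->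
  freealg_eval (fgen K x * fgen K y - c *: (fgen K y * fgen K x) - fgen K z) w = 0.
Proof.
move=> E; rewrite !(linB (freealg_eval_linl w)) (linZ (freealg_eval_linl w)).
by rewrite !freealg_evalM !freealg_eval_gen E -addrA -opprD subrr.
Qed.

End Evaluation.
End FreeAlgebra.

Lemma addr_eqs (V : zmodType) (x x' y y' : V) : x = x' -> y = y' -> x + y = x' + y'.
Proof. by move=> -> ->. Qed.

Lemma subr_eqs (V : zmodType) (x x' y y' : V) : x = x' -> y = y' -> x - y = x' - y'.
Proof. by move=> -> ->. Qed.

Section QuotientMaps.
Variable K : fieldType.

Lemma qpi_linear (V : lmodType K) (S : V -> Prop) : linear (qpi S).
Proof. by move=> c u v; rewrite qpiD qpiZ. Qed.

Lemma qpi0 (V : lmodType K) (S : V -> Prop) v : lin_span S v -> qpi S v = 0.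
Proof. by move=> Sv; rewrite -(lin0 (qpi_linear S)); apply/qpi_eq; rewrite subr0. Qed.

Lemma lin_span_ker (V W : lmodType K) (S : V -> Prop) (f : V -> W) :
  linear f -> (forall v, S v -> f v = 0) -> forall v, lin_span S v -> f v = 0.
Proof.
move=> fl fS; apply: lin_span_ind => //.
by split=> [|c u v fu fv]; rewrite ?(lin0 fl) // fl fu fv scaler0 addr0.
Qed.

Lemma quotv_lift (V W : lmodType K) (S : V -> Prop) (f : V -> W) :
  linear f -> (forall v, S v -> f v = 0) ->
  exists2 g : quotv S -> W, linear g & forall v, g (qpi S v) = f v.
Proof.
move=> fl fS; have gE v : f (qrepr (qpi S v)) = f v.
  apply/eqP; rewrite -subr_eq0 -(linB fl); apply/eqP.
  by apply: (lin_span_ker fl fS); apply/qpi_eq; rewrite qreprK.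
exists (fun x => f (qrepr x)) => // c x y.
by rewrite -{1}[x]qreprK -{1}[y]qreprK -qpi_linear gE fl.
Qed.

Lemma quota_scalerAl (T : algType K) (S : T -> Prop) c (x y : quota S) :
  (c *: x) * y = c *: (x * y).
Proof.
rewrite -[x]qreprK -[y]qreprK.
transitivity (qpi (ideal_gen S) (c *: qrepr x * qrepr y)).
  rewrite qpi_mul; congr (_ * _); exact: esym (qpiZ _ _ _).
rewrite -scalerAl qpiZ; congr (_ *: _); exact: qpi_mul.
Qed.

Lemma quota_mulr_linear (T : algType K) (S : T -> Prop) (y : quota S) :
  linear (fun x : quota S => x * y).
Proof. by move=> c u v; rewrite mulrDl quota_scalerAl. Qed.

Lemma ideal_gen_rel (T : algType K) (S : T -> Prop) r : S r -> ideal_gen S r.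
Proof. by move=> Sr; exists 1, r, 1; rewrite mul1r mulr1. Qed.

Lemma quota_qpiM (T : algType K) (S : T -> Prop) a b :
  (qpi (ideal_gen S) a : quota S) * (qpi (ideal_gen S) b : quota S) =
  qpi (ideal_gen S) (a * b).
Proof. exact: esym (qpi_mul _ _ _). Qed.

Lemma quota_qpi_linear (T : algType K) (S : T -> Prop) c a b :
  qpi (ideal_gen S) (c *: a + b) =
  c *: (qpi (ideal_gen S) a : quota S) + (qpi (ideal_gen S) b : quota S).
Proof. exact: qpi_linear. Qed.

End QuotientMaps.

(** Over the dual numbers, let x act by x + e d(x) with e^2 = 0. This is the coefficient of e in the
    relation x y = ± y x + [x,y], and it holds because d is a derivation of the bracket. *)
Lemma derived_bracket (K : fieldType) (V : lmodType K) (f g h f' g' h1 h2 h' : V -> V)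
    (e : K) :
  linear f -> linear g ->
  (forall u, f (g u) = e *: g (f u) + h u) ->
  (forall u, f' (g u) = e *: g (f' u) + h1 u) ->
  (forall u, f (g' u) = e *: g' (f u) + h2 u) ->
  (forall u, h' u = h1 u + h2 u) ->
  forall v w, f' (g v) + f (g' v + g w) =
    e *: (g' (f v) + g (f' v + f w)) + (h' v + h w).
Proof.
move=> fl gl H1 H2 H3 H4 v w.
rewrite (linD fl) (linD gl) H1 H2 H3 H4 !scalerDr.
by rewrite [LHS](AC (2*(2*2)) ((3*(1*5))*((2*4)*6))).
Qed.

Section Enveloping.
Variables (K : fieldType) (A : algType K) (sA : supercomm_algebra A).
Variables (B : lmodType K) (sB : vertex_algebroid sA B).

Local Notation AB := (A * B)%type.
Local Notation Lie := (Lie sB).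
Local Notation Env := (Env sB).
Local Notation VL := (VL sB).
Local Notation env_in := (@env_in K A sA B sB).
Local Notation act x := (VLact (env_in x)).

Lemma env_in_linear : linear env_in.
Proof.
move=> c x y; apply: (etrans _ (qpi_linear _ _ _ _)); apply/qpi_eq/span_gen.
exact/ideal_gen_rel/EnvLinear.
Qed.

Lemma env_in_br p q x y : Lie_hom p x -> Lie_hom q y ->
  env_in x * env_in y = eps p q *: (env_in y * env_in x) + env_in (Lie_br x y).
Proof.
move=> hx hy; rewrite /env_in !quota_qpiM -quota_qpi_linear.
apply/qpi_eq/span_gen/ideal_gen_rel; rewrite opprD addrA.
exact: EnvBracket.
Qed.

Lemma env_ind (P : Env -> Prop) :
  lin_closed P -> P 1 -> (forall x t, P t -> P (env_in x * t)) -> forall t, P t.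
Proof.
move=> Pl P1 PM t; rewrite -[t]qreprK.
move: (qrepr t); apply: freealg_ind => //.
  exact: (lin_closed_preim (qpi_linear _) Pl).
by move=> x s Ps; rewrite qpi_mul; apply: PM.
Qed.

Definition VLpi (x : Env) : VL := qpi (@induced_rel K A sA B sB) x.

Lemma VLpi_linear : linear VLpi.
Proof. exact: qpi_linear. Qed.

Lemma VLpi_surj v : exists x, v = VLpi x.
Proof. by exists (qrepr v); exact: esym (qreprK _). Qed.

Lemma VLact_VLpi x y : VLact x (VLpi y) = VLpi (x * y).
Proof. exact: VLact_pi. Qed.

Lemma VLact_linr x : linear (@VLact K A sA B sB x).
Proof.
move=> c u v; have [u' ->] := VLpi_surj u; have [v' ->] := VLpi_surj v.
transitivity (VLact x (VLpi (c *: u' + v'))).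
  by congr (VLact x _); exact: esym (VLpi_linear _ _ _).
by rewrite !VLact_VLpi mulrDr quota_scalerAr (VLpi_linear c).
Qed.

Lemma VLact_linl v : linear (fun x => @VLact K A sA B sB x v).
Proof.
move=> c x y; have [v' ->] := VLpi_surj v.
by rewrite !VLact_VLpi mulrDl quota_scalerAl (VLpi_linear c).
Qed.

Lemma VLact1 v : @VLact K A sA B sB 1 v = v.
Proof. by have [v' ->] := VLpi_surj v; rewrite VLact_VLpi mul1r. Qed.

Lemma VLactM x y v : @VLact K A sA B sB (x * y) v = VLact x (VLact y v).
Proof. by have [v' ->] := VLpi_surj v; rewrite !VLact_VLpi mulrA. Qed.

Lemma act_linl v : linear (fun x => act x v).
Proof. exact: linear_comp (VLact_linl v) env_in_linear. Qed.

Lemma act_br p q x y v : Lie_hom p x -> Lie_hom q y ->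
  act x (act y v) = eps p q *: act y (act x v) + act (Lie_br x y) v.
Proof.
by move=> hx hy; rewrite -!VLactM (env_in_br hx hy) (VLact_linl v).
Qed.

Lemma act_ge0 y : Lie_ge0 y -> act y (VLvac sB) = 0.
Proof.
move=> hy; rewrite /VLvac VLact_pi; apply/qpi0/span_gen.
by exists 1, y; rewrite [1 * _]mul1r [_ * 1]mulr1.
Qed.

Lemma VLact_closed (P : VL -> Prop) : lin_closed P ->
  (forall x v, P v -> P (act x v)) -> forall x v, P v -> P (VLact x v).
Proof.
move=> Pl PM x v Pv; move: x; apply: env_ind.
- exact: (lin_closed_preim (VLact_linl v) Pl).
- by rewrite VLact1.
- by move=> x t Pt; rewrite VLactM; apply: PM.
Qed.

Lemma VL_ind (P : VL -> Prop) : lin_closed P -> P (VLvac sB) ->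
  (forall x v, P v -> P (act x v)) -> forall v, P v.
Proof.
move=> Pl P1 PM v; suff -> : v = VLact (qrepr v) (VLvac sB) by exact: VLact_closed.
by rewrite /VLvac VLact_pi mulr1 qreprK.
Qed.

(** Frobenius reciprocity for the induced module. Evaluation of words at [w0] kills the relations of
    the enveloping algebra because [rho] respects brackets, and then those of the induced module
    because [Lie_ge0] annihilates [w0]. *)
Lemma VL_universal (W : lmodType K) (rho : Lie -> W -> W) (w0 : W) :
  (forall w, linear (rho^~ w)) -> (forall x, linear (rho x)) ->
  (forall p q x y w, Lie_hom p x -> Lie_hom q y ->
     rho x (rho y w) = eps p q *: rho y (rho x w) + rho (Lie_br x y) w) ->
  (forall y, Lie_ge0 y -> rho y w0 = 0) ->
  exists phi : VL -> W, [/\ linear phi, phi (VLvac sB) = w0 &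
    forall x v, phi (act x v) = rho x (phi v)].
Proof.
move=> rho_l rho_r rho_br rho0.
have [g [gl gM g1]] : exists g : Env -> W,
    [/\ linear g, forall x z, g (env_in x * z) = rho x (g z) & g 1 = w0].
  have ev_rel t : ideal_gen (@env_rel K A sA B sB) t -> freealg_eval rho t w0 = 0.
    move=> [a [r [b [hr ->]]]]; rewrite !(freealg_evalM rho_r).
    suff -> : freealg_eval rho r (freealg_eval rho b w0) = 0.
      exact: (lin0 (freealg_eval_linr rho_r a)).
    move: (freealg_eval rho b w0) => {}w; case: hr => [c x y|p q x y hx hy].
      by apply: freealg_eval_linear_rel => //; exact: rho_l.
    by apply: freealg_eval_br_rel => //; exact: rho_br.
  have [g gl gE] := quotv_lift (freealg_eval_linl rho w0) ev_rel.
  exists g; split=> //; last by rewrite -(freealg_eval1 rho w0) -gE.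
  move=> x z; rewrite -[z]qreprK.
  transitivity (freealg_eval rho (fgen K x * qrepr z) w0).
    apply: (etrans _ (gE _)); apply: (f_equal g); exact: quota_qpiM.
  by rewrite (freealg_eval_genM rho_r) gE.
have g_rel z : @induced_rel K A sA B sB z -> g z = 0.
  move=> [x [y [hy ->]]]; move: x; apply: env_ind.
  - exact: lin_closed_ker (linear_comp gl (quota_mulr_linear _)).
  - have -> : 1 * env_in y = env_in y * 1 by rewrite mul1r mulr1.
    by rewrite gM g1; exact: rho0.
  - by move=> x t ht; rewrite -mulrA gM ht (lin0 (rho_r x)).
have [phi phil phiE] := quotv_lift gl g_rel; exists phi; split=> //.
  by rewrite /VLvac phiE g1.
by move=> x v; rewrite -[v]qreprK VLact_pi !phiE gM.
Qed.

(* v |-> (v, T v) is the module map into VL * VL, on which x acts by            *)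
(* (v, w) |-> (x v, d(x) v + x w).                                              *)
Lemma VL_derivation (d : Lie -> Lie) : linear d ->
  (forall p x, Lie_hom p x -> Lie_hom p (d x)) ->
  (forall x y, d (Lie_br x y) = Lie_br (d x) y + Lie_br x (d y)) ->
  (forall y, Lie_ge0 y -> Lie_ge0 (d y)) ->
  exists T : VL -> VL, [/\ linear T, T (VLvac sB) = 0 &
    forall x v, T (act x v) = act (d x) v + act x (T v)].
Proof.
move=> dl dh dbr d0.
pose rho x (w : VL * VL) : VL * VL := (act x w.1, act (d x) w.1 + act x w.2).
have lact x : linear (act x) by exact: VLact_linr.
have ract v : linear (fun x => act x v) by exact: act_linl.
have [||||phi [phil phi1 phiE]] := @VL_universal (VL * VL)%type rho (VLvac sB, 0).
- move=> w c x y; congr (_, _) => /=; first exact: ract.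
  exact: (linear_add (linear_comp (ract w.1) dl) (ract w.2)).
- move=> x c u v; congr (_, _) => /=; first exact: lact.
  exact: (linear_add (linear_comp (lact (d x)) (@linear_fst _ _ _)) (linear_comp (lact x) (@linear_snd _ _ _))).
- move=> p q x y w hx hy; congr (_, _) => /=; first exact: act_br.
  apply: (@derived_bracket _ _ _ _ (act (Lie_br x y)) _ _
    (act (Lie_br (d x) y)) (act (Lie_br x (d y)))) => //.
  + exact: (fun u => act_br u hx hy).
  + exact: (fun u => act_br u (dh _ _ hx) hy).
  + exact: (fun u => act_br u hx (dh _ _ hy)).
  + by move=> u; rewrite dbr; exact: (linD (ract u)).
- by move=> y hy; congr (_, _) => /=; rewrite ?(lin0 (lact _)) ?addr0 act_ge0 //; exact: d0.
have phi_fst v : (phi v).1 = v.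
  move: v; apply: VL_ind => [||x v IH].
  - exact: lin_closed_eq (linear_comp (@linear_fst _ _ _) phil) (@linear_id _ _).
  - by rewrite phi1.
  - by rewrite phiE /= IH.
exists (fun v => (phi v).2); split=> [||x v].
- exact: linear_comp (@linear_snd _ _ _) phil.
- by rewrite phi1.
- by rewrite phiE /= phi_fst.
Qed.

End Enveloping.

(** * The derivations d_m *)

Section LoopDerivation.
Variables (K : fieldType) (A : algType K) (sA : supercomm_algebra A).
Variables (B : lmodType K) (sB : vertex_algebroid sA B).
Variable f : B -> A.
Hypothesis f_lin : linear f.
Hypothesis f_even : parity_map sB sA f.
Hypothesis f_der : forall a, f (va_der sB a) = 0.
Hypothesis f_br : forall u v,
  f (va_br sB u v) = a0b sB (f u) v + va_anchor sB u (f v).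

Local Notation AB := (A * B)%type.
Local Notation Lie := (Lie sB).

Lemma binz2 (m : int) : binz m 2 = (m%:~R * (m - 1)%:~R) / 2 :> K.
Proof. by rewrite /binz !big_ord_recl big_ord0 mulr1 subr0. Qed.

(** The commutation formula read on modes: (Du)(m+n+1) = -(m+n+1) u(m+n) comes from i = 0, the
    weight L(0) = 1 on B adds m + 1 from i = 1, and L(1) contributes the last summand from i = 2. *)
Definition mon_der (m : int) (u : AB) (n : int) : laurent AB :=
  lmon ((- (m + n + 1))%:~R *: u.1, (- n)%:~R *: u.2) (m + n)
  + lmon (binz (m + 1) 2 *: inA B (f u.2)) (m + n - 1).

Definition loop_der (m : int) : laurent AB -> laurent AB := lsum (mon_der m).

Lemma mon_der_lin m n : linear (fun u => mon_der m u n).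
Proof.
apply: linear_add; apply: linear_comp (lmon_lin _) _.
  by move=> c u v; congr (_, _); rewrite /= scalerDr !scalerA mulrC.
apply: linear_scale => c u v; congr (_, _) => /=; first exact: f_lin.
by rewrite scaler0 addr0.
Qed.

Lemma loop_der_lin m : linear (loop_der m).
Proof. exact: lsum_lin (mon_der_lin m). Qed.

Lemma loop_der_mon m u n : loop_der m (lmon u n) = mon_der m u n.
Proof. exact: lsum_mon (mon_der_lin m) _ _. Qed.

Lemma laurent_ind (V : lmodType K) (P : laurent V -> Prop) :
  lin_closed P -> (forall v n, P (lmon v n)) -> forall g, P g.
Proof. by move=> Pl PU g; rewrite (laurentE g); apply: lin_closed_sum. Qed.

(** On monomials, d_m of the total derivative of a t^n is the total derivative of -n a t^(m+n); the
    only other term contains f(∂a) = 0. *)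
Lemma loop_der_dhat m g : exists h, loop_der m (dhat sB g) = dhat sB h.
Proof.
have dl := dhat_lin sB; have Dl := loop_der_lin m.
move: g; apply: laurent_ind.
  split; first by exists 0; rewrite (lin0 dl) (lin0 Dl).
  by move=> c u v [h Eh] [k Ek]; exists (c *: h + k); rewrite (dl c u) (dl c h) (Dl c) Eh Ek.
move=> a n; exists ((- n)%:~R *: lmon a (m + n)).
rewrite (linZ dl) !dhat_mon (linD Dl) !loop_der_mon /mon_der /= f_der.
rewrite !scaler0 (lin0 f_lin).
have -> c : c *: inA B 0 = 0 :> AB by congr (_, _); rewrite /= scaler0.
have lm0 k : lmon 0 k = 0 :> laurent AB by exact: lin0 (lmon_lin _).
rewrite !lm0 !addr0 scalerDr.
have lmZ c (u : AB) k : c *: lmon u k = lmon (c *: u) k by rewrite (linZ (lmon_lin _)).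
rewrite !lmZ; congr (_ + _).
  by congr lmon; congr (_, _); rewrite /= scaler0.
rewrite addrA; congr lmon; congr (_, _); rewrite /= ?scaler0 //.
rewrite !scalerA -!intrM; congr (_%:~R *: _); ring.
Qed.

(** Two powers of t occur. At t^(m+p+q) the scalars of the two factors add up to that of the
    bracket. At t^(m+p+q-1) the pairing terms agree numerically, and the terms in f agree by
    [f_br]. *)
Lemma loop_der_br_mon m (u v : AB) p q :
  loop_der m (loop_br sB (lmon u p) (lmon v q)) =
  loop_br sB (loop_der m (lmon u p)) (lmon v q)
  + loop_br sB (lmon u p) (loop_der m (lmon v q)).
Proof.
case: u => a b; case: v => a' b'.
have Dl := loop_der_lin m; have lbl := loop_br_linl sB; have lbr := loop_br_linr sB.
have lmD k (x y : AB) : lmon x k + lmon y k = lmon (x + y) k.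
  exact: esym (linD (lmon_lin k) x y).
have lm0 k : lmon 0 k = 0 :> laurent AB by exact: lin0 (lmon_lin _).
have [an1 an2] := va_anchor_bilin sB; have [a01 a02] := a0b_bilin sB.
have [br1 br2] := br_bilin (va_br_leibniz sB); have [pr1 pr2] := va_pair_bilin sB.
set c : K := binz (m + 1) 2.
rewrite loop_br_mon !loop_der_mon /mon_br (linD Dl) !loop_der_mon /mon_der.
rewrite (linD (lbl _)) (linD (lbr _)) !loop_br_mon /mon_br /prod0 /prod1 /=.
rewrite -/c !(linZ (an1 _)) !(linZ (an2 _)) !(linZ (a01 _)) !(linZ (a02 _)).
rewrite !(linZ (br1 _)) !(linZ (br2 _)) !(linZ (pr1 _)) !(linZ (pr2 _)).
rewrite !scaler0.
rewrite (lin0 f_lin) (lin0 (an1 a')) (lin0 (br1 b')) (lin0 (pr1 b')).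
rewrite (lin0 (a02 a)) (lin0 (br2 b)) (lin0 (pr2 b)) /inA f_br.
have pZ (e : K) x y : e *: ((x, y) : AB) = (e *: x, e *: y) by [].
have pD x y x' y' : ((x, y) : AB) + (x', y') = (x + x', y + y') by [].
have p0 : ((0, 0) : AB) = 0 by [].
rewrite !pZ !scaler0 ?(add0r, addr0) !p0 !lm0 !addr0.
set s := m + p + q.
have -> : m + (p + q) = s by rewrite /s; ring.
have -> : m + (p + q - 1) = s - 1 by rewrite /s; ring.
have -> : m + p - 1 + q = s - 1 by rewrite /s; ring.
have -> : p + (m + q) = s by rewrite /s; ring.
have -> : p + (m + q - 1) = s - 1 by rewrite /s; ring.
rewrite [RHS](AC (3*3) ((1*4)*(2*3*(5*6)))).
rewrite [RHS]/=.
rewrite !lmD !pD -[LHS]addrA !lmD !pD.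
rewrite !addr0 !scalerA.
congr (_ + _); congr lmon; congr (_, _).
- rewrite [RHS](AC (2*2) ((1*3)*(2*4))) /= -!scalerDl -!intrD scalerDr.
  by congr (_%:~R *: _ + _%:~R *: _); rewrite /s; ring.
- by rewrite -scalerDl -intrD; congr (_%:~R *: _); ring.
rewrite scalerDr [RHS](AC (2*2) ((2*4)*(1*3))) /=; congr (_ + _).
by rewrite -scalerDl -!intrM -intrD; congr (_%:~R *: _); rewrite /s; ring.
Qed.

Lemma loop_der_br m g h :
  loop_der m (loop_br sB g h) =
  loop_br sB (loop_der m g) h + loop_br sB g (loop_der m h).
Proof.
have Dl := loop_der_lin m; have lbl := loop_br_linl sB; have lbr := loop_br_linr sB.
move: g; apply: laurent_ind.
  apply: lin_closed_eq; first exact: linear_comp Dl (lbl h).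
  exact: linear_add (linear_comp (lbl h) Dl) (lbl _).
move=> u p; move: h; apply: laurent_ind; last by move=> v q; exact: loop_der_br_mon.
apply: lin_closed_eq; first exact: linear_comp Dl (lbr _).
exact: linear_add (lbr _) (linear_comp (lbr _) Dl).
Qed.

Lemma loop_der_hom m p g : loop_hom sB p g -> loop_hom sB p (loop_der m g).
Proof.
move=> hg k; rewrite /homog /loop_der /lsum.
have hl : linear (ABcomp sB p) by exact: hcomp_linear (ABsuper sB) p.
rewrite -[hcomp (ABsuper sB) p]/(ABcomp sB p).
rewrite (lin_sum (mcoeff_lin k)) (lin_sum hl); apply: eq_bigr => n _.
have := hg n; case: (g@_n) => a b [ha hb].
have fb : hcomp sA p (f b) = f b by exact: f_even.
have zl : ABcomp sB p 0 = 0 by exact: lin0 hl.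
rewrite /mon_der mcoeffD !mcoeffU /=.
rewrite (linD hl); congr (_ + _); case: eqP => _; rewrite ?mulr0n ?zl // mulr1n.
  by congr (_, _); rewrite /= (linZ (hcomp_linear _ _)) ?ha ?hb.
congr (_, _); rewrite /= (linZ (hcomp_linear _ _)) ?fb //.
by rewrite (lin0 (hcomp_linear _ _)).
Qed.

Definition Lie_der (m : int) (x : Lie) : Lie :=
  qpi (@dhat_image K A sA B sB) (loop_der m (qrepr x)).

Lemma Lie_der_pi m g :
  Lie_der m (qpi (@dhat_image K A sA B sB) g) =
  qpi (@dhat_image K A sA B sB) (loop_der m g).
Proof.
apply/qpi_eq; rewrite -(linB (loop_der_lin m)).
set g' := qrepr _.
have Hg : lin_span (@dhat_image K A sA B sB) (g' - g) by apply/qpi_eq; rewrite qreprK.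
apply: (span_map (loop_der_lin m)) Hg => _ [h ->].
have [h' ->] := loop_der_dhat m h.
by apply: span_gen; exists h'.
Qed.

Lemma Lie_der_lin m : linear (Lie_der m).
Proof.
move=> c x y; rewrite -[x]qreprK -[y]qreprK -qpi_linear !Lie_der_pi.
by rewrite (loop_der_lin m) qpi_linear.
Qed.

Lemma Lie_der_br m x y :
  Lie_der m (Lie_br x y) = Lie_br (Lie_der m x) y + Lie_br x (Lie_der m y).
Proof.
rewrite -[x]qreprK -[y]qreprK !(Lie_der_pi, Lie_br_pi) loop_der_br.
exact: qpiD.
Qed.

Lemma Lie_der_hom m p x : Lie_hom p x -> Lie_hom p (Lie_der m x).
Proof.
move=> [g [hg ->]]; exists (loop_der m g); split; last exact: Lie_der_pi.
exact: loop_der_hom.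
Qed.

Lemma Lie_mode_lin n : linear (fun u => Lie_mode sB u n).
Proof. exact: linear_comp (qpi_linear _) (lmon_lin n). Qed.

Lemma Lie_der_mode m (u : AB) n :
  Lie_der m (Lie_mode sB u n) =
  Lie_mode sB ((- (m + n + 1))%:~R *: u.1, (- n)%:~R *: u.2) (m + n)
  + Lie_mode sB (binz (m + 1) 2 *: inA B (f u.2)) (m + n - 1).
Proof. by rewrite Lie_der_pi loop_der_mon; exact: qpiD. Qed.

Lemma Lie_der_ge0 m x : -1 <= m -> Lie_ge0 x -> Lie_ge0 (Lie_der m x).
Proof.
move=> m_ge; apply: (span_map (Lie_der_lin m)) => _ [u [n [n_ge ->]]].
have mode_ge0 v k : v = 0 \/ 0 <= k -> Lie_ge0 (Lie_mode sB v k).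
  move=> [->|k_ge]; first by rewrite (lin0 (Lie_mode_lin k)); exact: Span0.
  by apply: span_gen; exists v, k.
rewrite Lie_der_mode; apply: lin_closedD; first exact: lin_span_closed.
  apply: mode_ge0; case: (lerP 0 (m + n)) => [|lt0]; [by right | left].
  (* The one case where a mode becomes negative; both scalars -(m + n + 1) and -n are then zero. *)
  have [-> ->] : m = -1 /\ n = 0 by split; lia.
  by congr (_, _); rewrite scale0r.
apply: mode_ge0; case: (lerP 0 (m + n - 1)) => [|lt0]; [by right | left].
suff -> : binz (m + 1) 2 = 0 :> K by rewrite scale0r.
(* As n >= 0, a negative mode forces m <= 0, where m(m+1)/2 = 0. *)
have: m = -1 \/ m = 0 by lia.
by move=> [] ->; rewrite binz2 ?mul0r // subrr mulr0 mul0r.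
Qed.

End LoopDerivation.

(** * Modes on V_L and their commutators *)

Section Modes.
Variables (K : fieldType) (A : algType K) (sA : supercomm_algebra A).
Variables (B : lmodType K) (sB : vertex_algebroid sA B).

Local Notation AB := (A * B)%type.
Local Notation Lie := (Lie sB).
Local Notation VL := (VL sB).
Local Notation vac := (VLvac sB).
Implicit Types (v w : VL) (u : AB).

Lemma VLop_linr u n : linear (@VLop K A sA B sB u n).
Proof. exact: VLact_linr. Qed.

Lemma VLop_linl n v : linear (fun u => @VLop K A sA B sB u n v).
Proof. exact: linear_comp (act_linl v) (Lie_mode_lin sB n). Qed.

Lemma VLop_vac u n : 0 <= n -> VLop u n vac = 0.
Proof. by move=> n_ge; apply: act_ge0; apply: span_gen; exists u, n. Qed.

Lemma Lie_ind (P : Lie -> Prop) :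
  lin_closed P -> (forall u n, P (Lie_mode sB u n)) -> forall x, P x.
Proof.
move=> Pl Pm x; rewrite -[x]qreprK; move: (qrepr x); apply: laurent_ind => //.
exact: lin_closed_preim (qpi_linear _) Pl.
Qed.

Lemma VLact_mode_closed (P : VL -> Prop) : lin_closed P ->
  (forall u n v, P v -> P (VLop u n v)) -> forall x v, P v -> P (VLact x v).
Proof.
move=> Pl PM; apply: VLact_closed => // x v Pv; move: x; apply: Lie_ind => [|u n].
  exact: lin_closed_preim (act_linl v) Pl.
exact: PM.
Qed.

Lemma VL_mode_ind (P : VL -> Prop) : lin_closed P -> P vac ->
  (forall u n v, P v -> P (VLop u n v)) -> forall v, P v.
Proof.
move=> Pl P1 PM; apply: VL_ind => // x v Pv; move: x; apply: Lie_ind => [|u n].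
  exact: lin_closed_preim (act_linl v) Pl.
exact: PM.
Qed.

Lemma VLop_br p q (u u' : AB) m n v :
  homog (ABsuper sB) p u -> homog (ABsuper sB) q u' ->
  VLop u m (VLop u' n v) =
  eps p q *: VLop u' n (VLop u m v) +
  (VLop (prod0 sB u u') (m + n) v + m%:~R *: VLop (prod1 sB u u') (m + n - 1) v).
Proof.
have mode_hom r (w : AB) k : homog (ABsuper sB) r w -> Lie_hom r (Lie_mode sB w k).
  move=> hw; exists (lmon w k); split=> // j; rewrite mcoeffU.
  case: eqP => _; rewrite ?mulr1n // mulr0n.
  exact: lin0 (hcomp_linear (ABsuper sB) r).
move=> hu hu'; rewrite /VLop (act_br _ (mode_hom _ _ _ hu) (mode_hom _ _ _ hu')).
congr (_ + _); rewrite Lie_br_pi loop_br_mon /mon_br qpiD.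
rewrite (linD (act_linl v)); congr (_ + _).
rewrite -(linZ (act_linl v)); congr (VLact (env_in _) v).
exact: (linZ (Lie_mode_lin sB _)).
Qed.

Lemma VL_virasoro (f : B -> A) :
  linear f -> parity_map sB sA f -> (forall a, f (va_der sB a) = 0) ->
  (forall b b', f (va_br sB b b') = a0b sB (f b) b' + va_anchor sB b (f b')) ->
  forall m : int, -1 <= m -> exists T : VL -> VL, [/\ linear T, T vac = 0 &
    forall u n v, T (VLop u n v) = VLop u n (T v) +
      (VLop ((- (m + n + 1))%:~R *: u.1, (- n)%:~R *: u.2) (m + n) v
       + binz (m + 1) 2 *: VLop (inA B (f u.2)) (m + n - 1) v)].
Proof.
move=> f_lin f_even f_der f_br m m_ge.
have [||||T [T_lin T1 TE]] := @VL_derivation _ _ _ _ sB (@Lie_der K A sA B sB f m).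
- exact: Lie_der_lin.
- by move=> p x; exact: Lie_der_hom.
- by move=> x y; exact: Lie_der_br.
- by move=> y; exact: Lie_der_ge0.
exists T; split=> [//|//|u n v]; apply: etrans (TE _ _) _.
rewrite [LHS]addrC; congr (_ + _); rewrite (Lie_der_mode f_lin f_der).
apply: etrans (linD (act_linl v) _ _) _; congr (_ + _).
apply: etrans (linZ (act_linl v) _ _); congr (VLact (env_in _) v).
exact: (linZ (Lie_mode_lin sB _)).
Qed.

End Modes.

(** * Vertex superalgebras *)

Section IntegerBinomials.
Variable K : fieldType.
Hypothesis char0 : forall n, n.+1%:R != 0 :> K.

Lemma fact_neq0 n : n`!%:R != 0 :> K.
Proof. by have := fact_gt0 n; case: (n`!)%N. Qed.

Lemma intr_eq0_char0 (m : int) : m%:~R = 0 :> K -> m = 0.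
Proof.
case: m => [[|n]|n] //; first by move/eqP; rewrite (negbTE (char0 n)).
by rewrite NegzE mulrNz => /eqP; rewrite oppr_eq0 (negbTE (char0 n)).
Qed.

Lemma binz0 m : binz m 0 = 1 :> K.
Proof. by rewrite /binz big_ord0 divr1. Qed.

Lemma binz1 m : binz m 1 = m%:~R :> K.
Proof. by rewrite /binz big_ord1 subr0 divr1. Qed.

Lemma binz_nat (n i : nat) : binz n i = 'C(n, i)%:R :> K.
Proof.
rewrite /binz; apply: (canLR (mulfK (fact_neq0 i))).
rewrite -natrM bin_ffact ffact_prod; case: (leqP i n) => [le_in|lt_ni].
  rewrite natr_prod; apply: eq_bigr => j _.
  by rewrite subzn // (leq_trans (ltnW (ltn_ord j))).
rewrite (bigD1 (Ordinal lt_ni)) //= subrr mul0r.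
by rewrite (bigD1 (Ordinal lt_ni)) //= subnn mul0n.
Qed.

(** These coefficients arise from the Jacobi identity with l = -2, that is, from D u = u_(-2) 1. *)
Lemma binzN2 i : (-1) ^+ i * binz (-2) i = i.+1%:R :> K.
Proof.
have prodE : \prod_(j < i) (-2 - j%:Z)%:~R = (-1) ^+ i * i.+1`!%:R :> K.
  elim: i => [|i IH]; first by rewrite big_ord0 mulr1.
  rewrite big_ord_recr /= IH exprS (factS i.+1) natrM.
  have -> : (-2 - i%:Z)%:~R = - i.+2%:R :> K.
    by rewrite -opprD mulrNz -[2 + i%:Z]/(i.+2%:Z).
  by ring.
rewrite /binz prodE mulrA mulrA -expr2 -exprM mulnC exprM sqrrN expr1n expr1n mul1r.
by rewrite factS natrM mulfK ?fact_neq0.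
Qed.

End IntegerBinomials.

Section VertexSuperalgebra.
Variables (K : fieldType) (V : lmodType K) (Y : vertex_superalgebra V).
Hypothesis char0 : forall n, n.+1%:R != 0 :> K.

Local Notation vac := (vvac Y).
Local Notation mode := (vmode Y).
Local Notation D := (vD Y).

Lemma homog_ind (W : lmodType K) (sW : superspace W) (P : W -> Prop) :
  lin_closed P -> (forall p v, homog sW p v -> P v) -> forall v, P v.
Proof.
move=> Pl Ph v; rewrite (hcompD sW v); apply: lin_closedD => //;
  apply: (Ph _ _ (hcomp_homog _ _ _)).
Qed.

Lemma homog_closed (W : lmodType K) (sW : superspace W) p : lin_closed (homog sW p).
Proof. exact: lin_closed_eq (hcomp_linear sW p) (@linear_id _ _). Qed.

Lemma vmode_linl n v : linear (fun u => mode u n v).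
Proof. by case: (vmode_bilin Y n) => + _; apply. Qed.

Lemma vmode_linr u n : linear (mode u n).
Proof. by case: (vmode_bilin Y n) => _; apply. Qed.

Lemma vD_linear : linear D.
Proof. exact: vmode_linl. Qed.

Lemma vD_vac : D vac = 0.
Proof. by rewrite /vD vvac_id. Qed.

Lemma vD_homog p u : homog Y p u -> homog Y p (D u).
Proof.
move=> hu; have := vmode_parity (-2) hu (vvac_even Y).
by rewrite addbF.
Qed.

(** The Jacobi identity applied to the vacuum, with exponents n, 0, -2: the left side is (u_n
    v)_(-2) 1, and on the right only v_(-2) 1 = D v and v_(-1) 1 = v survive. *)
Lemma vD_vmode u n v : D (mode u n v) = mode u n (D v) - n%:~R *: mode u (n - 1) v.
Proof.
have lin_in_u v' : linear (fun u => mode u n (D v') - n%:~R *: mode u (n - 1) v').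
  by apply: linear_sub (vmode_linl _ _) _; apply: linear_scale (vmode_linl _ _).
have lin_in_v u' : linear (fun v => mode u' n (D v) - n%:~R *: mode u' (n - 1) v).
  apply: linear_sub; first exact: linear_comp (vmode_linr _ _) vD_linear.
  exact: linear_scale (vmode_linr _ _).
move: u; apply: (homog_ind (sW := vsuper Y)).
  exact: lin_closed_eq (linear_comp vD_linear (vmode_linl n v)) (lin_in_u v).
move=> p u hu; move: v; apply: (homog_ind (sW := vsuper Y)).
  exact: lin_closed_eq (linear_comp vD_linear (vmode_linr u n)) (lin_in_v u).
move=> q v hv; have [N0 /(_ N0.+2)] := vborcherds vac n 0 (-2) hu hv.
rewrite !big_ord_recl => /(_ (leq_trans (leqnSn _) (leqnSn _))).
rewrite !big1 ?addr0; first last.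
- by move=> i _; rewrite !lift0 binz_nat // bin0n scale0r.
- move=> i _; rewrite !lift0 (vcreation0 Y v) ?(vcreation0 Y u) //.
  by rewrite !(lin0 (vmode_linr _ _)) scaler0 subr0 scaler0.
rewrite !lift0 !binz_nat // !bin0n !binz0 binz1 scale1r scale0r addr0 expr0 expr1.
rewrite !(vcreation0 Y u) // !(lin0 (vmode_linr _ _)) !scaler0 !subr0.
by rewrite vcreation !add0r mul1r scale1r mulN1r scaleNr.
Qed.

(** The Jacobi identity with v the vacuum and l = -2. Since the vacuum has only the mode -1, at most
    one term remains on the right, with scalar -n: from the first product if n < 0 and from the
    second if n > 0. *)
Lemma vmode_vD u n w : mode (D u) n w = - (n%:~R *: mode u (n - 1) w).
Proof.
move: u; apply: (homog_ind (sW := vsuper Y)).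
  apply: lin_closed_eq; first exact: linear_comp (vmode_linl n w) vD_linear.
  move=> c u v; rewrite (vmode_linl (n - 1) w c u v) scalerDr opprD scalerN.
  by rewrite !scalerA mulrC.
move=> p u hu; have [N0 HN] := vborcherds w (-2) 0 n hu (vvac_even Y).
(* The surviving index is -n-1 or n-1 according to the sign of n; for n = 0 the term at k = 0
   vanishes as well. *)
pose k := (`|n|.-1)%N; pose N := (maxn N0 k.+1); have kN : (k < N)%N by exact: leq_maxr.
have := HN N (leq_maxl _ _); rewrite (bigD1 (Ordinal (leq_ltn_trans (leq0n k) kN))) //=.
rewrite big1 ?addr0; last first.
  case=> -[|i] lti //= _; rewrite binz_nat // bin0n scale0r //.
rewrite binz0 scale1r [0 + n]add0r => ->.
have termE (i : 'I_N) : ((-1) ^+ i * binz (-2) i) *: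
    (mode u (0 - 2 - i%:Z) (mode vac (n + i%:Z) w)
     - ((-1) ^ (-2) * eps p false) *: mode vac (n - 2 - i%:Z) (mode u (0 + i%:Z) w)) =
    i.+1%:R *: ((if n == - i.+1%:Z then mode u (n - 1) w else 0)
                - (if n == i.+1%:Z then mode u (n - 1) w else 0)).
  rewrite binzN2 //; congr (_ *: (_ - _)).
    rewrite vvac_id; have -> : (n + i%:Z == -1) = (n == - i.+1%:Z) by lia.
    case: eqP => [->|_]; last exact: lin0 (vmode_linr _ _).
    by congr mode; lia.
  rewrite /eps andbF mulr1 vvac_id.
  have -> : (n - 2 - i%:Z == -1) = (n == i.+1%:Z) by lia.
  have -> : (-1) ^ (-2) = 1 :> K by rewrite -[(-1) ^ (-2)]/(((-1) ^+ 2)^-1) sqrrN expr1n invr1.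
  rewrite scale1r; case: eqP => [->|//].
  by congr mode; lia.
under eq_bigr => i _ do rewrite termE.
rewrite (bigD1 (Ordinal kN)) //= big1 ?addr0; last first.
  move=> i /eqP ik; have {}ik : (i : nat) <> k by move=> E; apply: ik; apply: val_inj.
  rewrite !ifN ?subr0 ?scaler0 //; apply/eqP => E; apply: ik; rewrite /k E; lia.
move: HN => _; case: n @k @N kN termE => [[|n]|n] k N kN _.
- by rewrite /= subr0 scale0r oppr0 scaler0.
- by rewrite /k /= eqxx sub0r scalerN.
by rewrite /k /= eqxx subr0 -scaleNr NegzE mulrNz opprK.
Qed.

End VertexSuperalgebra.

(** * The commutation formula for products of fields *)

Section CommutatorFormula.
Variables (K : fieldType) (V : lmodType K) (Y : vertex_superalgebra V).
Hypothesis char0 : forall n, n.+1%:R != 0 :> K.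
Variable X : nat -> V -> V.
Hypothesis X_lin : forall M, linear (X M).
Hypothesis X_even : forall M, even_op Y (X M).

Local Notation mode := (vmode Y).

(* [X M] stands for L(M - 1), so that the binomials below are natural.          *)
Definition comm_formula_nat (M : nat) (u : V) : Prop := forall n v,
  X M (mode u n v) - mode u n (X M v) =
  \sum_(j < M.+1) 'C(M, j)%:R *: mode (X j u) (M%:Z - j%:Z + n) v.

(** A summand of the right side of the Jacobi identity. The sign [e] is a separate parameter because
    it stays the same when an even operator is applied to u or v. *)
Definition borcherds_term (e : K) u v (l m n : int) w (i : nat) : V :=
  ((-1) ^+ i * binz l i) *:
    (mode u (m + l - i%:Z) (mode v (n + i%:Z) w)
     - e *: mode v (n + l - i%:Z) (mode u (m + i%:Z) w)).

(** For a natural exponent m the binomials vanish beyond i = m, so the left side is an exact finite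
    sum and only the right side depends on a truncation. *)
Lemma borcherds_nat p q u v w l (m : nat) n : homog Y p u -> homog Y q v ->
  exists N0 : nat, forall N, (N0 <= N)%N ->
    \sum_(i < m.+1) 'C(m, i)%:R *: mode (mode u (l + i%:Z) v) (m%:Z + n - i%:Z) w =
    \sum_(i < N) borcherds_term ((-1) ^ l * eps p q) u v l m n w i.
Proof.
move=> hu hv; have [N0 HN] := vborcherds w l m n hu hv.
exists (maxn N0 m.+1) => N; rewrite geq_max => /andP[leN0 lem].
rewrite -(HN N leN0) (big_ord_widen N (fun i => 'C(m, i)%:R *: mode (mode u (l + i%:Z) v) (m%:Z + n - i%:Z) w)) //.
rewrite big_mkcond; apply: eq_bigr => i _; rewrite binz_nat // ltnS.
by case: leqP => // lt_mi; rewrite bin_small // scale0r.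
Qed.

Lemma comm_formula_nat2 M u v a b w :
  comm_formula_nat M u -> comm_formula_nat M v ->
  X M (mode u a (mode v b w)) - mode u a (mode v b (X M w)) =
  \sum_(j < M.+1) 'C(M, j)%:R *: mode (X j u) (M%:Z - j%:Z + a) (mode v b w)
  + \sum_(j < M.+1) 'C(M, j)%:R *: mode u a (mode (X j v) (M%:Z - j%:Z + b) w).
Proof.
move=> cu cv; have ul := vmode_linr Y u a.
rewrite -(cu a (mode v b w)).
under [X in _ = _ + X]eq_bigr => j _ do rewrite -(linZ ul).
by rewrite -(lin_sum ul) -(cv b w) (linB ul) addrA subrK.
Qed.

(** Commuting past the modes of u moves the exponent m from 0 to M - j, and commuting past those of
    v moves n to M - j + n: the result is again made of Jacobi summands. *)
Lemma comm_borcherds_term M e u v l n w i :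
  comm_formula_nat M u -> comm_formula_nat M v ->
  X M (borcherds_term e u v l 0 n w i) - borcherds_term e u v l 0 n (X M w) i =
  \sum_(j < M.+1) 'C(M, j)%:R *: borcherds_term e (X j u) v l (M%:Z - j%:Z) n w i
  + \sum_(j < M.+1) 'C(M, j)%:R *: borcherds_term e u (X j v) l 0 (M%:Z - j%:Z + n) w i.
Proof.
move=> cu cv; rewrite /borcherds_term; move: ((-1) ^+ i * _) => c.
have E P Q P' Q' : X M (c *: (P - e *: Q)) - c *: (P' - e *: Q') =
    c *: ((X M P - P') - e *: (X M Q - Q')).
  rewrite (linZ (X_lin M)) (linB (X_lin M)) (linZ (X_lin M)) -scalerBr.
  by congr (_ *: _); rewrite [e *: (_ - _)]scalerBr !opprB [LHS](AC (2*2) ((1*4)*(3*2))).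
rewrite E.
rewrite (comm_formula_nat2 _ _ _ cu cv) (comm_formula_nat2 _ _ _ cv cu).
set S1 := \sum_(j < _) _; set S2 := \sum_(j < _) _; set S3 := \sum_(j < _) _.
set S4 := \sum_(j < _) _.
have Q x y d : c *: (d *: x - e *: (d *: y)) = d *: (c *: (x - e *: y)) :> V.
  by rewrite [e *: (d *: y)]scalerA (mulrC e) -scalerA -scalerBr !scalerA (mulrC d).
transitivity (c *: (S1 - e *: S4) + c *: (S2 - e *: S3)).
  rewrite -scalerDr; congr (_ *: _); rewrite scalerDr opprD.
  by rewrite [LHS](AC (2*2) ((1*4)*(2*3))).
congr (_ + _).
  rewrite /S1 /S4 [e *: (\sum_(j < _) _)]scaler_sumr -sumrB scaler_sumr; apply: eq_bigr => j _.
  rewrite Q; by congr (_ *: (_ *: (mode _ _ _ - _ *: mode _ _ (mode _ _ _)))); ring.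
rewrite /S2 /S3 [e *: (\sum_(j < _) _)]scaler_sumr -sumrB scaler_sumr; apply: eq_bigr => j _.
rewrite Q; by congr (_ *: (_ *: (mode _ _ (mode _ _ _) - _ *: mode _ _ _))); ring.
Qed.

(** Each Jacobi identity has its own truncation bound; finitely many of them share one. *)
Lemma eventually_ord k (P : 'I_k -> nat -> Prop) :
  (forall j, exists N0, forall N, (N0 <= N)%N -> P j N) ->
  exists N0, forall N, (N0 <= N)%N -> forall j, P j N.
Proof.
move=> /choice[f fP]; exists (\max_j f j) => N leN j.
by apply: fP; apply: leq_trans leN; apply: leq_bigmax.
Qed.

Lemma bin_mul_bin M s j : (j <= s <= M)%N ->
  ('C(M, s) * 'C(s, j) = 'C(M, j) * 'C(M - j, s - j))%N.
Proof.
move=> /andP[js sM]; have jM := leq_trans js sM.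
apply/eqP; rewrite -(eqn_pmul2r (fact_gt0 j)) -(eqn_pmul2r (fact_gt0 (s - j))).
rewrite -(eqn_pmul2r (fact_gt0 (M - s))); apply/eqP.
have E1 := bin_fact sM; have E2 := bin_fact js; have E3 := bin_fact jM.
have E4 := bin_fact (leq_sub2r j sM); have E5 : (M - j - (s - j) = M - s)%N by lia.
rewrite E5 in E4.
transitivity M`!; first by rewrite -E1 -E2; lia.
by rewrite -E3 -E4; lia.
Qed.

Lemma triangular_binomial_sum (G : nat -> nat -> V) M :
  \sum_(s < M.+1) 'C(M, s)%:R *: (\sum_(j < s.+1) 'C(s, j)%:R *: G j s) =
  \sum_(j < M.+1) 'C(M, j)%:R *:
    (\sum_(i < (M - j).+1) 'C(M - j, i)%:R *: G j (i + j)%N).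
Proof.
transitivity (\sum_(s < M.+1) \sum_(j < M.+1 | (j <= s)%N)
    ('C(M, s) * 'C(s, j))%:R *: G j s).
  apply: eq_bigr => s _; rewrite scaler_sumr.
  rewrite (big_ord_widen M.+1 (fun j => 'C(M, s)%:R *: ('C(s, j)%:R *: G j s))) //.
  by apply: eq_bigr => j _; rewrite scalerA natrM.
rewrite (exchange_big_dep xpredT) //=; apply: eq_bigr => j _.
rewrite scaler_sumr.
transitivity (\sum_(j <= s < M.+1) ('C(M, s) * 'C(s, j))%:R *: G j s).
  by rewrite big_geq_mkord.
rewrite -{1}[j : nat]add0n big_addn.
have -> : (M.+1 - j = (M - j).+1)%N by have := ltn_ord j; lia.
rewrite big_mkord; apply: eq_bigr => i _; rewrite scalerA -natrM bin_mul_bin ?addnK //.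
by have := ltn_ord i; have := ltn_ord j; lia.
Qed.

(* L(M-1) applied to the Borcherds identity with m = 0 gives the identities     *)
(* with m = M - j, which recombine by C(M,s) C(s,j) = C(M,j) C(M-j,s-j).        *)
Lemma comm_formula_nat_vmode p q u v l : homog Y p u -> homog Y q v ->
  (forall M, comm_formula_nat M u) -> (forall M, comm_formula_nat M v) ->
  forall M, comm_formula_nat M (mode u l v).
Proof.
move=> hu hv cu cv M n w; set e : K := (-1) ^ l * eps p q.
have [N1 HN1] := borcherds_nat w l 0 n hu hv.
have [N2 HN2] := borcherds_nat (X M w) l 0 n hu hv.
have [N3 HN3] := eventually_ord (fun j : 'I_M.+1 =>
  borcherds_nat w l (M - j) n (X_even j hu) hv).
have [N4 HN4] := eventually_ord (fun j : 'I_M.+1 =>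
  borcherds_nat w l 0 (M%:Z - j%:Z + n) hu (X_even j hv)).
pose N := (maxn (maxn N1 N2) (maxn N3 N4)).
have {HN1}E1 := HN1 N (leq_trans (leq_maxl _ _) (leq_maxl _ _)).
have {HN2}E2 := HN2 N (leq_trans (leq_maxr _ _) (leq_maxl _ _)).
have {HN3}E3 := HN3 N (leq_trans (leq_maxl _ _) (leq_maxr _ _)).
have {HN4}E4 := HN4 N (leq_trans (leq_maxr _ _) (leq_maxr _ _)).
rewrite !big_ord1 bin0 !scale1r addr0 add0r subr0 -/e in E1 E2.
rewrite E1 E2 (lin_sum (X_lin M)) -sumrB.
under eq_bigr => i _ do rewrite (comm_borcherds_term _ _ _ _ _ (cu M) (cv M)).
rewrite big_split exchange_big /= [X in _ + X]exchange_big /=.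
transitivity (\sum_(j < M.+1) 'C(M, j)%:R *: (\sum_(i < (M - j).+1) 'C(M - j, i)%:R *:
     mode (mode (X j u) ((i + j)%N%:Z - j%:Z + l) v) (M%:Z - (i + j)%N%:Z + n) w)
   + \sum_(j < M.+1) 'C(M, j)%:R *: mode (mode u l (X j v)) (M%:Z - j%:Z + n) w).
  congr (_ + _); apply: eq_bigr => j _; rewrite -scaler_sumr; congr (_ *: _).
    have jM : (M - j)%N%:Z = M%:Z - j%:Z by rewrite -subzn // -ltnS.
    rewrite -jM -E3; apply: eq_bigr => i _; congr (_ *: mode (mode _ _ _) _ _); lia.
  by rewrite /e -E4 big_ord1 bin0 scale1r addr0 add0r subr0.
rewrite -(triangular_binomial_sum (fun j s =>
  mode (mode (X j u) (s%:Z - j%:Z + l) v) (M%:Z - s%:Z + n) w)) -big_split.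
apply: eq_bigr => s _ /=; rewrite -scalerDr; congr (_ *: _).
have ml := vmode_linl Y (M%:Z - s%:Z + n) w.
rewrite -[X s (mode u l v)](subrK (mode u l (X s v))) (cu s) (linD ml) (lin_sum ml).
by congr (_ + _); apply: eq_bigr => j _; rewrite (linZ ml).
Qed.

End CommutatorFormula.

(** * Operators with integer eigenvalues *)

Section IntegerEigenspaces.
Variables (K : fieldType) (V : lmodType K) (T : V -> V).
Hypothesis char0 : forall n, n.+1%:R != 0 :> K.
Hypothesis T_lin : linear T.

(** Applying T - k to the relation removes the term of eigenvalue k and multiplies each other one by
    n - k, which is invertible in characteristic 0; the shorter relation is covered by induction. *)
Lemma eigen_independent (s : seq int) (w : int -> V) :
  uniq s -> (forall n, T (w n) = n%:~R *: w n) -> \sum_(n <- s) w n = 0 ->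
  forall n, n \in s -> w n = 0.
Proof.
elim: s w => [//|k s IH] w /= /andP[ks us] Tw; rewrite big_cons => sum0.
have w0 n : n \in s -> w n = 0.
  move=> ns; have nk : n - k != 0.
    by rewrite subr_eq0; apply: contraNneq ks => <-.
  have /IH : forall n, T ((n - k)%:~R *: w n) = n%:~R *: ((n - k)%:~R *: w n).
    by move=> j; rewrite (linZ T_lin) Tw !scalerA mulrC.
  move=> /(_ us); have -> : \sum_(j <- s) (j - k)%:~R *: w j = 0.
    have S : \sum_(j <- s) w j = - w k by apply/eqP; rewrite -addr_eq0 addrC sum0.
    have TS : \sum_(j <- s) j%:~R *: w j = k%:~R *: \sum_(j <- s) w j.
      rewrite S scalerN -(Tw k) -scaleN1r -(linZ T_lin) scaleN1r -S (lin_sum T_lin).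
      by apply: eq_bigr => j _; rewrite Tw.
    under eq_bigr => j _ do rewrite intrB scalerBl.
    by rewrite sumrB TS scaler_sumr subrr.
  move=> /(_ erefl n ns)/eqP; rewrite scaler_eq0 => /orP[/eqP/(intr_eq0_char0 char0)/eqP|/eqP//].
  by rewrite (negbTE nk).
move=> n; rewrite inE => /predU1P[->|]; last exact: w0.
by move: sum0; rewrite big_seq big1 ?addr0 // => j; exact: w0.
Qed.

Hypothesis T_span : forall v, lin_span (fun w => exists d : nat, T w = d%:R *: w) v.

Lemma nat_eigen_decomposition v : exists w : nat -> V,
  (forall n, T (w n) = n%:R *: w n) /\
  exists N0, forall N, (N0 <= N)%N -> v = \sum_(n < N) w n.
Proof.
move: v (T_span v); apply: lin_span_ind; first split.
- exists (fun=> 0); split=> [n|]; first by rewrite (lin0 T_lin) scaler0.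
  by exists 0%N => N _; rewrite big1.
- move=> c u v [w [Tw [N Ew]]] [w' [Tw' [N' Ew']]].
  exists (fun n => c *: w n + w' n); split=> [n|].
    by rewrite T_lin Tw Tw' scalerDr !scalerA mulrC.
  exists (maxn N N') => M; rewrite geq_max => /andP[leN leN'].
  by rewrite {1}(Ew M leN) {1}(Ew' M leN') scaler_sumr -big_split.
move=> u [d Td]; exists (fun n => if n == d then u else 0); split=> [n|].
  by case: eqP => [->|] //; rewrite (lin0 T_lin) scaler0.
exists d.+1 => N ltdN; rewrite (bigD1 (Ordinal ltdN)) //= eqxx big1 ?addr0 //.
by move=> i; rewrite -val_eqE /= => /negbTE ->.
Qed.

Lemma neg_eigen_eq0 (n : int) v : n < 0 -> T v = n%:~R *: v -> v = 0.
Proof.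
move=> n_lt0 Tv; have [w [Tw [N /(_ N (leqnn N)) vE]]] := nat_eigen_decomposition v.
(* The components of v together with -v, placed at its own negative eigenvalue, form a vanishing sum
   of eigenvectors with distinct eigenvalues. *)
pose w' (k : int) := if k == n then - v else if k is Posz i then w i else 0.
have Tw' k : T (w' k) = k%:~R *: w' k.
  rewrite /w'; case: eqP => [->|_]; first by rewrite -scaleN1r (linZ T_lin) Tv !scalerA mulrC.
  by case: k => k; rewrite ?Tw // (lin0 T_lin) scaler0.
have w'_nat i : w' (Posz i) = w i.
  by rewrite /w' ifN //; apply/eqP => E; rewrite -E in n_lt0.
have := @eigen_independent (n :: [seq Posz i | i <- iota 0 N]) w' _ Tw' _ n.
rewrite inE eqxx /= {2}/w' eqxx => H; apply/oppr_inj; rewrite oppr0; apply: H => //.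
  rewrite map_inj_uniq ?iota_uniq ?andbT => [|i j [] //].
  by apply/negP => /mapP[i _ E]; rewrite E in n_lt0.
rewrite big_cons {1}/w' eqxx big_map (eq_bigr _ (fun i _ => w'_nat i)).
by rewrite -[X in iota 0 X]subn0 -/(index_iota 0 N) big_mkord -vE addNr.
Qed.

Lemma eigen_direct_sum : direct_sum (fun (n : int) v => T v = n%:~R *: v).
Proof.
split=> [v|s w us Tw sum0]; last exact: eigen_independent.
apply: (lin_span_ind (lin_span_closed _)) (T_span v) => u [d Td].
by apply: span_gen; exists d.
Qed.

End IntegerEigenspaces.

(** * Operators controlled by a generating subspace *)

Section GeneratedVertexSuperalgebra.
Variables (K : fieldType) (V : lmodType K) (Y : vertex_superalgebra V).
Hypothesis char0 : forall n, n.+1%:R != 0 :> K.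
Variables (U : lmodType K) (sU : superspace U) (gen : U -> V).
Hypothesis gen_parity : parity_map sU Y gen.
Variables l0 l1 : U -> U.
Hypotheses (l0_even : even_op sU l0) (l1_even : even_op sU l1).

Local Notation vac := (vvac Y).
Local Notation mode := (vmode Y).

Inductive gen_word : bool -> V -> Prop :=
| GenVac : gen_word false vac
| GenMode p q u n v : homog sU p u -> gen_word q v ->
    gen_word (p (+) q) (mode (gen u) n v).

Hypothesis gen_span : forall v, lin_span (fun w => exists p, gen_word p w) v.

(** The conditions that give a recursion for L(m) along words in the modes of generators
    ([gext_mode]). *)
Record gen_extension (L : int -> V -> V) : Prop := GenExtension {
  gext_lin : forall m : int, -1 <= m -> linear (L m);
  gext_D : forall v, L (-1) v = vD Y v;
  gext_0 : forall u, L 0 (gen u) = gen (l0 u);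
  gext_1 : forall u, L 1 (gen u) = gen (l1 u);
  gext_comm : forall (m : int) u, -1 <= m -> comm_formula Y L m 3 (gen u)
}.

Lemma gen_word_homog p v : gen_word p v -> homog Y p v.
Proof.
elim=> [|q r u n w hu _ hw]; first exact: vvac_even.
by apply: vmode_parity => //; exact: gen_parity.
Qed.

Section Extension.
Variable L : int -> V -> V.
Hypothesis LE : gen_extension L.

Lemma gext_mode (m : int) u n v : -1 <= m ->
  L m (mode (gen u) n v) = mode (gen u) n (L m v) +
    (binz (m + 1) 0 *: mode (vD Y (gen u)) (m + 1 + n) v
     + binz (m + 1) 1 *: mode (gen (l0 u)) (m + n) v
     + binz (m + 1) 2 *: mode (gen (l1 u)) (m - 1 + n) v).
Proof.
move=> m_ge; have := gext_comm LE u m_ge n v.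
rewrite !big_ord_recl big_ord0 /= => /(canRL (subrK _)) ->.
rewrite [LHS]addrC; congr (_ + _); rewrite addr0 addrA; congr (_ + _ + _).
- by rewrite -[0%:Z - 1]/(- 1 : int) (gext_D LE).
- by rewrite -[(bump 0 0)%:Z - 1]/(0 : int) (gext_0 LE) addrK.
rewrite -[(bump 0 (bump 0 0))%:Z - 1]/(1 : int) (gext_1 LE).
have -> : m + 1 - (bump 0 (bump 0 0))%:Z + n = m - 1 + n by rewrite /bump /=; lia.
by rewrite addr0.
Qed.

(** Parity is preserved on words by the recursion; as words are homogeneous and span, L(m) commutes
    with the projections onto the homogeneous components. *)
Lemma gext_even (m : int) : -1 <= m -> L m vac = 0 -> even_op Y (L m).
Proof.
move=> m_ge Lvac; have L_lin := gext_lin LE m_ge.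
have hl p := hcomp_linear (vsuper Y) p.
have word_even q v : gen_word q v -> homog Y q (L m v).
  elim=> [|p r u n w hu hw IH].
    by rewrite Lvac; exact: (lin0 (hl false)).
  have gh := gen_parity hu; have wh := gen_word_homog hw.
  have hc := homog_closed (vsuper Y) (p (+) r).
  rewrite (gext_mode _ _ _ m_ge); apply: (lin_closedD hc).
    exact: vmode_parity.
  apply: (lin_closedD hc); first apply: (lin_closedD hc).
  - apply: (lin_closedZ _ hc); apply: vmode_parity => //; exact: vD_homog.
  - apply: (lin_closedZ _ hc); apply: vmode_parity => //; exact/gen_parity/l0_even.
  apply: (lin_closedZ _ hc); apply: vmode_parity => //; exact/gen_parity/l1_even.
suff comm p v : L m (hcomp Y p v) = hcomp Y p (L m v).
  by move=> p v hv; rewrite /homog -comm hv.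
move: v (gen_span v); apply: lin_span_ind.
  by apply: lin_closed_eq; [exact: linear_comp L_lin (hl p) | exact: linear_comp (hl p) L_lin].
move=> v [q wv]; have /(hcomp_other p) -> := gen_word_homog wv.
have /(hcomp_other p) -> := word_even q v wv.
by case: eqP => // _; exact: lin0.
Qed.

Hypothesis L_vac : forall m : int, -1 <= m -> L m vac = 0.

(** Write the generator as its mode -1 applied to the vacuum. The modes left by the recursion are m,
    m - 1 and m - 2, all nonnegative from m = 2 on, so they kill the vacuum. *)
Lemma gext_gen0 (m : int) u : 2 <= m -> L m (gen u) = 0.
Proof.
move=> m_ge; have m_ge1 : -1 <= m by lia.
rewrite -(vcreation Y (gen u)) (gext_mode _ _ _ m_ge1) (L_vac m_ge1).
rewrite (lin0 (vmode_linr _ _ _)) !(vcreation0 Y); try lia.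
by rewrite !scaler0 !addr0.
Qed.

Local Notation X := (fun M : nat => L (M%:Z - 1)).

(** The sums over i < 3 and over i <= M coincide: terms with i >= 3 vanish by [gext_gen0], those
    with i > M because the binomial does. *)
Lemma gext_comm_gen M u : comm_formula_nat Y X M (gen u).
Proof.
have M_ge : -1 <= M%:Z - 1 by lia.
move=> n v; rewrite (gext_comm LE _ M_ge) subrK.
pose F i := binz M%:Z i *: mode (L (i%:Z - 1) (gen u)) (M%:Z - i%:Z + n) v.
have Fvanish i : (3 <= i)%N || (M < i)%N -> F i = 0.
  rewrite /F => /orP[i_ge|i_gt].
    by rewrite gext_gen0 ?(lin0 (vmode_linl _ _ _)) ?scaler0 //; lia.
  by rewrite binz_nat // bin_small // scale0r.
have widen k : (forall i, (k <= i)%N -> F i = 0) -> (k <= M + 3)%N ->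
    \sum_(i < k) F i = \sum_(i < M + 3) F i.
  move=> F0 k_le; rewrite (big_ord_widen (M + 3) F) // big_mkcond.
  by apply: eq_bigr => i _; case: ltnP => // /F0 ->.
transitivity (\sum_(i < M.+1) F i); last first.
  by apply: eq_bigr => i _; rewrite /F binz_nat.
rewrite [LHS](widen 3) ?leq_addl //; last by move=> i i_ge; rewrite Fvanish ?i_ge.
rewrite widen // => [i i_gt|]; last by rewrite addnS ltnS leq_addr.
by rewrite Fvanish // i_gt orbT.
Qed.

Lemma gext_comm_all M u : comm_formula_nat Y X M u.
Proof.
have X_lin j : linear (X j) by apply: (gext_lin LE); lia.
have X_even j : even_op Y (X j).
  have j_ge : -1 <= j%:Z - 1 by lia.
  exact: gext_even (L_vac j_ge).
suff word_comm q v : gen_word q v -> forall M, comm_formula_nat Y X M v.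
  move=> n w; move: u (gen_span u); apply: lin_span_ind; last first.
    by move=> v [q wv]; exact: (word_comm q v wv M n w).
  apply: lin_closed_eq.
    apply: linear_sub; first exact: linear_comp (X_lin M) (vmode_linl _ _ _).
    exact: vmode_linl.
  apply: linear_bigsum => j; apply: linear_scale.
  exact: linear_comp (vmode_linl _ _ _) (X_lin j).
elim=> [|p r x n w hx hw IH].
  move=> {}M n w; rewrite big1 => [|j _].
    rewrite !vvac_id; case: ifP => _; rewrite ?subrr // (lin0 (X_lin M)).
    exact: subrr.
  by rewrite L_vac ?(lin0 (vmode_linl _ _ _)) ?scaler0 //; lia.
exact: (comm_formula_nat_vmode char0 X_lin X_even n (gen_parity hx)
  (gen_word_homog hw) (gext_comm_gen^~ x) IH).
Qed.

Lemma gext_sc_comm (m : int) u : -1 <= m -> comm_formula Y L m (absz (m + 2)) u.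
Proof.
move=> m_ge; have [M ->] : exists M : nat, m = M%:Z - 1.
  by exists (absz (m + 1)); lia.
have -> : absz (M%:Z - 1 + 2) = M.+1 by lia.
move=> n v; rewrite subrK; have := gext_comm_all M u n v => /= ->.
by apply: eq_bigr => j _; rewrite binz_nat.
Qed.

End Extension.

(** The recursion along words involves only [l0], [l1] and D besides the value of L(m) on a shorter
    word, hence the vacuum decides. *)
Lemma gext_unique (L L' : int -> V -> V) (m : int) :
  gen_extension L -> gen_extension L' -> -1 <= m -> L' m vac = L m vac ->
  L' m =1 L m.
Proof.
move=> LE LE' m_ge Evac v; move: v (gen_span v); apply: lin_span_ind.
  by apply: lin_closed_eq; [exact: (gext_lin LE') | exact: (gext_lin LE)].
move=> v [p]; elim=> // {}p q u n w _ _ IH.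
by rewrite (gext_mode LE' _ _ _ m_ge) (gext_mode LE _ _ _ m_ge) IH.
Qed.
End GeneratedVertexSuperalgebra.

(** * The operators on V_L *)

Section VirasoroOperators.
Variables (K : fieldType) (A : algType K) (sA : supercomm_algebra A).
Variables (B : lmodType K) (sB : vertex_algebroid sA B).

Local Notation AB := (A * B)%type.
Local Notation VL := (VL sB).
Local Notation vac := (VLvac sB).
Local Notation opA a n v := (@VLop K A sA B sB (inA B a) n v).
Local Notation opB b n v := (@VLop K A sA B sB (inB A b) n v).

Lemma AB_split (u : AB) : u = inA B u.1 + inB A u.2.
Proof. by case: u => a b; congr (_, _); rewrite /= ?addr0 ?add0r. Qed.

Lemma inA_linear : linear (@inA K A B).
Proof. by move=> c a a'; congr (_, _); rewrite /= scaler0 addr0. Qed.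

Lemma inB_linear : linear (@inB K A B).
Proof. by move=> c b b'; congr (_, _); rewrite /= scaler0 addr0. Qed.

Lemma opA_linl n v : linear (fun a => opA a n v).
Proof. exact: linear_comp (VLop_linl n v) inA_linear. Qed.

Lemma opB_linl n v : linear (fun b => opB b n v).
Proof. exact: linear_comp (VLop_linl n v) inB_linear. Qed.

Lemma VLop_split (u : AB) n v : VLop u n v = opA u.1 n v + opB u.2 n v.
Proof. by rewrite {1}[u]AB_split; exact: (linD (VLop_linl n v)). Qed.

Lemma VL_AB_ind (P : VL -> Prop) : lin_closed P -> P vac ->
  (forall a n v, P v -> P (opA a n v)) -> (forall b n v, P v -> P (opB b n v)) ->
  forall v, P v.
Proof.
move=> Pl P1 PA PB; apply: VL_mode_ind => // u n v Pv.
by rewrite VLop_split; apply: lin_closedD; auto.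
Qed.

(* Homogeneous words in negative modes, with their parity and weight.           *)
Inductive negword : bool -> nat -> VL -> Prop :=
| NegVac : negword false 0 vac
| NegA p q a k d w : homog sA p a -> negword q d w ->
    negword (p (+) q) (k + d) (opA a (- k.+1%:Z) w)
| NegB p q b k d w : homog sB p b -> negword q d w ->
    negword (p (+) q) (k.+1 + d) (opB b (- k.+1%:Z) w).

Definition negspan : VL -> Prop := lin_span (fun w => exists p d, negword p d w).

Lemma negspan_neg (u : AB) k w : negspan w -> negspan (VLop u (- k.+1%:Z) w).
Proof.
apply: (span_map (VLop_linr u _)) => {}w [q [d hw]].
rewrite VLop_split; apply: lin_closedD; first exact: lin_span_closed.
  move: u.1; apply: (homog_ind (sW := alg_super sA)).
    exact: lin_closed_preim (opA_linl _ _) (lin_span_closed _).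
  by move=> p a ha; apply: span_gen; exists (p (+) q), (k + d)%N; exact: NegA.
move: u.2; apply: (homog_ind (sW := va_super sB)).
  exact: lin_closed_preim (opB_linl _ _) (lin_span_closed _).
by move=> p b hb; apply: span_gen; exists (p (+) q), (k.+1 + d)%N; exact: NegB.
Qed.

Lemma inA_homog p a : homog sA p a -> homog (ABsuper sB) p (inA B a).
Proof. by move=> ha; congr (_, _) => //=; exact: (lin0 (hcomp_linear _ _)). Qed.

Lemma inB_homog p b : homog sB p b -> homog (ABsuper sB) p (inB A b).
Proof. by move=> hb; congr (_, _) => //=; exact: (lin0 (hcomp_linear _ _)). Qed.

(** A nonnegative mode is moved to the right through the word. The swapped term and the two bracket
    terms are modes applied to a shorter word, and at the end a nonnegative mode kills the vacuum.
    No ordering of the letters is required. *)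
Lemma negspan_op_word q d w : negword q d w -> forall (u : AB) n, negspan (VLop u n w).
Proof.
have closed n w' : lin_closed (fun u : AB => negspan (VLop u n w')).
  exact: lin_closed_preim (VLop_linl n w') (lin_span_closed _).
have step p (x : AB) k w' : homog (ABsuper sB) p x ->
    (forall u n, negspan (VLop u n w')) ->
    forall u n, 0 <= n -> negspan (VLop u n (VLop x (- k.+1%:Z) w')).
  move=> hx IH u n _; move: u; apply: (homog_ind (sW := ABsuper sB)) => [|r u hu].
    exact: closed.
  rewrite (VLop_br _ _ _ hu hx); apply: lin_closedD; first exact: lin_span_closed.
    apply: lin_closedZ; first exact: lin_span_closed.
    by apply: negspan_neg; exact: IH.
  apply: lin_closedD; [exact: lin_span_closed | exact: IH |].
  by apply: lin_closedZ; [exact: lin_span_closed | exact: IH].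
have neg q' d' w' u k : negword q' d' w' -> negspan (VLop u (Negz k) w').
  by move=> hw'; rewrite NegzE; apply: negspan_neg; apply: span_gen; exists q', d'.
elim=> [|p {}q a k {}d {}w ha hw IH|p {}q b k {}d {}w hb hw IH] u [n|n].
- by rewrite VLop_vac //; exact: Span0.
- exact: neg NegVac.
- exact: step (inA_homog ha) IH _ _ _.
- exact: neg (NegA k ha hw).
- exact: step (inB_homog hb) IH _ _ _.
- exact: neg (NegB k hb hw).
Qed.

Lemma negword_span v : negspan v.
Proof.
move: v; apply: VL_mode_ind; first exact: lin_span_closed.
  by apply: span_gen; exists false, 0%N; exact: NegVac.
move=> u n v; apply: (span_map (VLop_linr u n)) => w [q [d hw]].
exact: negspan_op_word hw u n.
Qed.

Variable f : B -> A.
Hypothesis f_lin : linear f.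
Hypothesis f_even : parity_map sB sA f.
Hypothesis f_der : forall a, f (va_der sB a) = 0.
Hypothesis f_br : forall u v,
  f (va_br sB u v) = a0b sB (f u) v + va_anchor sB u (f v).

Record virasoro_ops (T : int -> VL -> VL) : Prop := VirasoroOps {
  vo_lin : forall m, -1 <= m -> linear (T m);
  vo_vac : forall m, -1 <= m -> T m vac = 0;
  vo_A : forall m a n v, -1 <= m ->
    T m (opA a n v) = opA a n (T m v) - (m + n + 1)%:~R *: opA a (m + n) v;
  vo_B : forall m b n v, -1 <= m ->
    T m (opB b n v) = opB b n (T m v) - n%:~R *: opB b (m + n) v
      + binz (m + 1) 2 *: opA (f b) (m + n - 1) v
}.

Lemma virasoro_ops_exist : exists T, virasoro_ops T.
Proof.
pose P (m : int) (T : VL -> VL) := -1 <= m -> [/\ linear T, T vac = 0 &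
  forall (u : AB) n v, T (VLop u n v) = VLop u n (T v) +
    (VLop ((- (m + n + 1))%:~R *: u.1, (- n)%:~R *: u.2) (m + n) v
     + binz (m + 1) 2 *: VLop (inA B (f u.2)) (m + n - 1) v)].
have /choice[T TP] : forall m, exists T, P m T.
  move=> m; case: (boolP (-1 <= m)) => [m_ge|m_lt]; last first.
    by exists (fun v => v) => m_ge; rewrite m_ge in m_lt.
  by have [T TP] := VL_virasoro f_lin f_even f_der f_br m_ge; exists T.
exists T; split=> [m /TP[]//|m /TP[]//|m a n v /TP[_ _ ->]|m b n v /TP[_ _ ->]].
  congr (_ + _); rewrite /= (lin0 f_lin) (lin0 (opA_linl (m + n - 1) v)).
  rewrite !scaler0 addr0 VLop_split /= (lin0 (opB_linl _ _)) addr0 (linZ (opA_linl _ _)).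
  by rewrite mulrNz scaleNr.
rewrite addrA; congr (_ + _ + _); rewrite VLop_split /= scaler0.
by rewrite (lin0 (opA_linl _ _)) add0r (linZ (opB_linl _ _)) mulrNz scaleNr.
Qed.

End VirasoroOperators.

(** * The Virasoro relations along words *)

Section VirasoroRelation.
Variables (K : fieldType) (A B V : lmodType K) (f : B -> A).
Hypothesis char0 : forall n, n.+1%:R != 0 :> K.
Variables (opA : A -> int -> V -> V) (opB : B -> int -> V -> V).
Hypothesis opA_linl : forall n v, linear (fun a => opA a n v).
Hypothesis opA_linr : forall a n, linear (opA a n).
Hypothesis opB_linr : forall a n, linear (opB a n).
Variable T : int -> V -> V.

Local Notation c2 m := (binz (m + 1) 2 : K).

(* [L(m), a(n)] and [L(m), b(n)], with f = L(1) on B.                           *)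
Definition commA m := forall a n v,
  T m (opA a n v) = opA a n (T m v) - (m + n + 1)%:~R *: opA a (m + n) v.
Definition commB m := forall b n v,
  T m (opB b n v) = opB b n (T m v) - n%:~R *: opB b (m + n) v
    + c2 m *: opA (f b) (m + n - 1) v.

Lemma virasoro_opA m n a k v :
  linear (T m) -> linear (T n) -> commA m -> commA n ->
  T m (T n (opA a k v)) - T n (T m (opA a k v)) =
  opA a k (T m (T n v) - T n (T m v))
  - ((m - n) * (m + n + k + 1))%:~R *: opA a (m + n + k) v.
Proof.
move=> Tm Tn Am An; rewrite Am An (linB Tm) (linB Tn) (linZ Tm) (linZ Tn) !Am !An.
rewrite (linB (opA_linr a k)).
have -> : n + (m + k) = m + n + k by ring.
have -> : m + (n + k) = m + n + k by ring.
move: (opA a k (T m _)) (opA a k (T n _)) (opA a (m + n + k) v) => x y z.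
move: (opA a (m + k) _) (opA a (n + k) _) => p q.
rewrite !scalerBr !scalerA !opprD !opprK -!intrM.
rewrite [LHS](AC ((2*2)*(2*2)) ((1*5)*((2*7)*(3*6)*(4*8)))) /=.
rewrite !addNr !add0r -scalerBl -intrB -scaleNr -rmorphN.
by congr (_ + _%:~R *: _); ring.
Qed.

(** The mixed terms cancel in pairs. With c(m) = m(m+1)/2, the scalar of the f(b) term is (m+n)(c(m)
    - c(n)), which equals (m-n) c(m+n). *)
Lemma virasoro_opB m n b k v :
  linear (T m) -> linear (T n) -> commA m -> commA n -> commB m -> commB n ->
  T m (T n (opB b k v)) - T n (T m (opB b k v)) =
  opB b k (T m (T n v) - T n (T m v))
  - ((m - n) * k)%:~R *: opB b (m + n + k) v
  + ((m - n)%:~R * c2 (m + n)) *: opA (f b) (m + n + k - 1) v.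
Proof.
move=> Tm Tn Am An Bm Bn; rewrite Bm Bn.
rewrite (linD Tm) (linD Tn) (linB Tm) (linB Tn) !(linZ Tm) !(linZ Tn).
rewrite !Bm !Bn !Am !An (linB (opB_linr b k)).
have -> : n + (m + k) = m + n + k by ring.
have -> : m + (n + k) = m + n + k by ring.
have -> : n + (m + k - 1) = m + n + k - 1 by ring.
have -> : m + (n + k - 1) = m + n + k - 1 by ring.
move: (opB b k (T m _)) (opB b k (T n _)) (opB b (m + n + k) v) => x y z.
move: (opB b (m + k) _) (opB b (n + k) _) => p q.
move: (opA _ (m + k - 1) _) (opA _ (n + k - 1) _) (opA _ (m + n + k - 1) v).
move=> r s t.
rewrite !scalerDr !scalerN !scalerA !opprD !opprK -!intrM.
rewrite [LHS](AC ((3*3*2)*(3*3*2))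
  ((1*9)*((2*12)*(15*3)*(4*10)*(11*7))*(5*13)*((14*16)*(6*8)))) /=.
rewrite !addNr !addr0 -!scaleNr -!scalerDl; congr (_ + _ *: _ + _ *: _).
  by rewrite -!rmorphN -intrD; congr (_%:~R); ring.
rewrite !binz2; field; exact: (char0 1).
Qed.

Lemma virasoro_opA_step m n a k v :
  linear (T m) -> linear (T n) -> commA m -> commA n -> commA (m + n) ->
  T m (T n v) - T n (T m v) = (m - n)%:~R *: T (m + n) v ->
  T m (T n (opA a k v)) - T n (T m (opA a k v)) = (m - n)%:~R *: T (m + n) (opA a k v).
Proof.
move=> Tm Tn Am An Amn IH; rewrite virasoro_opA // IH Amn (linZ (opA_linr a k)).
by rewrite scalerBr scalerA -intrM.
Qed.

Lemma virasoro_opB_step m n b k v :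
  linear (T m) -> linear (T n) -> commA m -> commA n ->
  commB m -> commB n -> commB (m + n) ->
  T m (T n v) - T n (T m v) = (m - n)%:~R *: T (m + n) v ->
  T m (T n (opB b k v)) - T n (T m (opB b k v)) = (m - n)%:~R *: T (m + n) (opB b k v).
Proof.
move=> Tm Tn Am An Bm Bn Bmn IH; rewrite virasoro_opB // IH Bmn (linZ (opB_linr b k)).
by rewrite scalerDr scalerBr !scalerA -intrM.
Qed.

End VirasoroRelation.

Lemma scaler_diff (K : fieldType) (V : lmodType K) (c d e : K) (z : V) :
  d - c = e -> d *: z - c *: z = e *: z.
Proof. by move=> <-; rewrite scalerBl. Qed.

Section VirasoroOnVL.
Variables (K : fieldType) (A : algType K) (sA : supercomm_algebra A).
Variables (B : lmodType K) (sB : vertex_algebroid sA B).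
Hypothesis char0 : forall n, n.+1%:R != 0 :> K.

Local Notation AB := (A * B)%type.
Local Notation VL := (VL sB).
Local Notation vac := (VLvac sB).
Local Notation opA a n v := (@VLop K A sA B sB (inA B a) n v).
Local Notation opB b n v := (@VLop K A sA B sB (inB A b) n v).

Variable f : B -> A.
Variable T : int -> VL -> VL.
Hypothesis VO : virasoro_ops f T.

Lemma VL_virasoro_bracket (m n : int) v : -1 <= m -> -1 <= n ->
  T m (T n v) - T n (T m v) = (m - n)%:~R *: T (m + n) v.
Proof.
(* Equal indices are treated apart: otherwise m = n = -1 would involve the index -2, while distinct
   m, n >= -1 have m + n >= -1. *)
move=> m_ge n_ge; case: (eqVneq m n) => [->|mn]; first by rewrite !subrr scale0r.
have mn_ge : -1 <= m + n by lia.
have Tm := vo_lin VO m_ge; have Tn := vo_lin VO n_ge; have Tmn := vo_lin VO mn_ge.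
have Am a k w := vo_A VO a k w m_ge; have An a k w := vo_A VO a k w n_ge.
have Amn a k w := vo_A VO a k w mn_ge; have Bm b k w := vo_B VO b k w m_ge.
have Bn b k w := vo_B VO b k w n_ge; have Bmn b k w := vo_B VO b k w mn_ge.
have Ar a k := VLop_linr (sB := sB) (inA B a) k.
have Br b k := VLop_linr (sB := sB) (inB A b) k.
move: v; apply: VL_AB_ind => [||a k v IH|b k v IH].
- apply: lin_closed_eq; last exact: linear_scale Tmn.
  exact: linear_sub (linear_comp Tm Tn) (linear_comp Tn Tm).
- rewrite (vo_vac VO m_ge) (vo_vac VO n_ge) (vo_vac VO mn_ge).
  by rewrite (lin0 Tm) (lin0 Tn) subr0 scaler0.
- exact: (virasoro_opA_step (opA := fun a n v => opA a n v) Ar a k Tm Tn Am An Amn IH).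
exact: (virasoro_opB_step char0 (opA := fun a n v => opA a n v)
  (opB := fun b n v => opB b n v) Br b k Tm Tn Am An Bm Bn Bmn IH).
Qed.

Lemma negword_weight q d w : negword (sB := sB) q d w -> T 0 w = d%:R *: w.
Proof.
have m_ge : -1 <= 0 :> int by [].
elim=> [|p {}q a k {}d {}w ha hw IH|p {}q b k {}d {}w hb hw IH].
- by rewrite (vo_vac VO) // scale0r.
- rewrite (vo_A VO _ _ _ m_ge) IH add0r (linZ (VLop_linr (inA B a) _)).
  apply: scaler_diff; rewrite -[d%:R]/((Posz d)%:~R) -intrB.
  by have -> : d%:Z - (- k.+1%:Z + 1) = (k + d)%N%:Z by lia.
rewrite (vo_B VO _ _ _ m_ge) IH !add0r (linZ (VLop_linr (inB A b) _)).
have -> : binz 1 2 = 0 :> K by rewrite binz2 subrr mulr0 mul0r.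
rewrite scale0r addr0; apply: scaler_diff.
rewrite -[d%:R]/((Posz d)%:~R) -intrB.
by have -> : d%:Z - (- k.+1%:Z) = (k.+1 + d)%N%:Z by lia.
Qed.

Variable YL : vertex_superalgebra VL.
Hypothesis hYL : VL_structure YL.

(** Both operators kill the vacuum and have the same commutators with modes: at m = -1 the scalars m
    + n + 1 and n agree and m(m+1)/2 is zero. *)
Lemma VL_translation v : T (-1) v = vD YL v.
Proof.
have m_ge : -1 <= -1 :> int by [].
have VLop_mode (u : AB) n w : VLop u n w = vmode YL (VLin sB u) n w.
  by rewrite (VL_mode hYL).
have D_op (u : AB) n w : vD YL (VLop u n w) =
    VLop u n (vD YL w) - n%:~R *: VLop u (n - 1) w.
  by rewrite !VLop_mode; exact: vD_vmode.
move: v; apply: VL_AB_ind => [||a n v IH|b n v IH].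
- exact: lin_closed_eq (vo_lin VO m_ge) (vD_linear YL).
- by rewrite (vo_vac VO m_ge) -(VL_vac hYL) vD_vac.
- rewrite (vo_A VO _ _ _ m_ge) D_op IH.
  have -> : -1 + n + 1 = n by ring.
  have -> : -1 + n = n - 1 by ring.
  reflexivity.
rewrite (vo_B VO _ _ _ m_ge) D_op IH.
have -> : binz (-1 + 1) 2 = 0 :> K by rewrite binz2 mul0r mul0r.
have -> : -1 + n = n - 1 by ring.
rewrite scale0r addr0; reflexivity.
Qed.

End VirasoroOnVL.

(** * Stability of E and of I_B *)

Section IdealStability.
Variables (K : fieldType) (A : algType K) (sA : supercomm_algebra A).
Variables (B : lmodType K) (sB : vertex_algebroid sA B).
Hypothesis char0 : forall n, n.+1%:R != 0 :> K.

Local Notation AB := (A * B)%type.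
Local Notation VL := (VL sB).
Local Notation vac := (VLvac sB).
Local Notation opA a n v := (@VLop K A sA B sB (inA B a) n v).
Local Notation opB b n v := (@VLop K A sA B sB (inB A b) n v).

Lemma prod0_inA_inB a b : prod0 sB (inA B a) (inB A b) = inA B (a0b sB a b).
Proof.
congr (_, _) => /=; last exact: lin0 ((br_bilin (va_br_leibniz sB)).1 _).
by rewrite (lin0 ((va_anchor_bilin sB).1 _)) add0r.
Qed.

Lemma opA_opA_vac a a' (n k : int) : 0 <= n -> opA a n (opA a' k vac) = 0.
Proof.
move=> n_ge; move: a; apply: (homog_ind (sW := alg_super sA)) => [|p a ha].
  exact: lin_closed_ker (opA_linl n (opA a' k vac)).
move: a'; apply: (homog_ind (sW := alg_super sA)) => [|q a' ha'].
  exact: lin_closed_ker (linear_comp (VLop_linr (inA B a) n) (opA_linl k vac)).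
rewrite (VLop_br _ _ _ (inA_homog sB ha) (inA_homog sB ha')) (VLop_vac sB (inA B a) n_ge).
have -> : prod0 sB (inA B a) (inA B a') = 0.
  congr (_, _) => /=; last exact: lin0 ((br_bilin (va_br_leibniz sB)).1 _).
  rewrite (lin0 ((va_anchor_bilin sB).1 _)) add0r.
  exact: lin0 ((a0b_bilin sB).2 _).
have -> : prod1 sB (inA B a) (inA B a') = 0.
  by congr (_, _) => /=; exact: lin0 ((va_pair_bilin sB).1 _).
by rewrite (lin0 (VLop_linr _ _)) !(lin0 (VLop_linl _ _)) !scaler0 !addr0.
Qed.

Lemma opA_opB_vac a b (n k : int) : 0 <= n ->
  opA a n (opB b k vac) = opA (a0b sB a b) (n + k) vac.
Proof.
move=> n_ge; have [al ar] := a0b_bilin sB.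
move: a; apply: (homog_ind (sW := alg_super sA)) => [|p a ha].
  apply: lin_closed_eq (opA_linl n (opB b k vac)) _.
  exact: linear_comp (opA_linl (n + k) vac) (al b).
move: b; apply: (homog_ind (sW := va_super sB)) => [|q b hb].
  apply: lin_closed_eq; first exact: linear_comp (VLop_linr (inA B a) n) (opB_linl k vac).
  exact: linear_comp (opA_linl (n + k) vac) (ar a).
rewrite (VLop_br _ _ _ (inA_homog sB ha) (inB_homog hb)) (VLop_vac sB (inA B a) n_ge).
rewrite prod0_inA_inB.
have -> : prod1 sB (inA B a) (inB A b) = 0.
  by congr (_, _) => /=; exact: lin0 ((va_pair_bilin sB).1 _).
by rewrite (lin0 (VLop_linr _ _)) (lin0 (VLop_linl _ _)) !scaler0 addr0 add0r.
Qed.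

Variable f : B -> A.
Hypothesis f_act : forall a b, f (va_act sB a b) = a * f b - a0b sB a b.
Variable T : int -> VL -> VL.
Hypothesis VO : virasoro_ops f T.

Lemma virasoro_VLinA (m : int) a : 0 <= m -> T m (VLin sB (inA B a)) = 0.
Proof.
move=> m_ge; have m_ge1 : -1 <= m by lia.
apply: etrans (vo_A VO a (-1) vac m_ge1) _.
rewrite (vo_vac VO m_ge1) (lin0 (VLop_linr _ _)) sub0r subrK.
case: (ltrP 0 m) => [m_gt|m_le].
  by rewrite (VLop_vac sB) ?scaler0 ?oppr0 //; lia.
have -> : m = 0 by lia.
by rewrite mulr0z scale0r oppr0.
Qed.

Lemma virasoro_VLinB (m : int) b : 0 <= m ->
  T m (VLin sB (inB A b)) = if m == 0 then VLin sB (inB A b)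
    else if m == 1 then VLin sB (inA B (f b)) else 0.
Proof.
move=> m_ge; have m_ge1 : -1 <= m by lia.
apply: etrans (vo_B VO b (-1) vac m_ge1) _.
rewrite (vo_vac VO m_ge1) (lin0 (VLop_linr _ _)) sub0r -scaleNr mulrNz opprK scale1r.
rewrite binz2 addrK.
case: eqP => [->|m_neq0]; first by rewrite mulr0 mul0r scale0r addr0.
rewrite (VLop_vac sB) ?add0r; last by lia.
case: eqP => [->|m_neq1]; last by rewrite (VLop_vac sB) ?scaler0 //; lia.
rewrite mulr1 divff ?scale1r //; exact: (char0 1).
Qed.

Lemma virasoro_opA_VLinA (m : int) a a' : 0 <= m ->
  T m (opA a (-1) (VLin sB (inA B a'))) = 0.
Proof.
move=> m_ge; have m_ge1 : -1 <= m by lia.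
apply: etrans (vo_A VO a (-1) _ m_ge1) _; rewrite (virasoro_VLinA a' m_ge).
rewrite (lin0 (VLop_linr (inA B a) (-1))) sub0r subrK; apply/eqP; rewrite oppr_eq0; apply/eqP.
case: (ltrP 0 m) => [m_gt|m_le]; last by (have -> : m = 0 by lia); rewrite mulr0z scale0r.
have E : opA a (m - 1) (VLin sB (inA B a')) = 0 by apply: opA_opA_vac; lia.
by rewrite E scaler0.
Qed.

(** The correction has scalar 0 at m = 0 and a mode that kills the vacuum for m >= 2. At m = 1 it is
    a_0 b, exactly the defect in the rule for f(ab). *)
Lemma virasoro_opA_VLinB (m : int) a b : 0 <= m ->
  T m (opA a (-1) (VLin sB (inB A b))) =
  opA a (-1) (T m (VLin sB (inB A b))) - m%:~R *: opA (a0b sB a b) (m - 2) vac.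
Proof.
move=> m_ge; have m_ge1 : -1 <= m by lia.
apply: etrans (vo_A VO a (-1) _ m_ge1) (subr_eqs erefl _); rewrite subrK.
case: (ltrP 0 m) => [m_gt|m_le]; last first.
  have -> : m = 0 by lia.
  exact: etrans (scale0r _) (esym (scale0r _)).
have E : opA a (m - 1) (VLin sB (inB A b)) = opA (a0b sB a b) (m - 2) vac.
  have -> : m - 2 = m - 1 + (-1) by ring.
  by apply: opA_opB_vac; lia.
exact: (f_equal (fun z => m%:~R *: z) E).
Qed.

(** All the images are 0 except for a(-1)b - ab, which T_0 fixes and T_1 sends to a(-1)f(b) - a
    f(b), again a generator of E. *)
Lemma virasoro_Egen (m : int) e : 0 <= m -> Egen e ->
  lin_span (@Egen K A sA B sB) (T m e).
Proof.
move=> m_ge; have m_ge1 : -1 <= m by lia.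
have TB := linB (vo_lin VO m_ge1).
have VA := linear_comp (VLop_linl (-1) vac) (@inA_linear K A B).
case=> [|a a'|a b].
- rewrite (etrans (TB _ _) (subr_eqs (virasoro_VLinA 1 m_ge) (vo_vac VO m_ge1))) subrr.
  exact: Span0.
- rewrite (etrans (TB _ _) (subr_eqs (virasoro_opA_VLinA a a' m_ge)
    (virasoro_VLinA (a * a') m_ge))) subrr; exact: Span0.
rewrite (etrans (TB _ _) (subr_eqs (virasoro_opA_VLinB a b m_ge)
    (virasoro_VLinB (va_act sB a b) m_ge))) (virasoro_VLinB b m_ge).
case: eqP => [->|m_neq0].
  by rewrite mulr0z scale0r subr0; apply: span_gen; exact: EgenB.
case: eqP => [->|m_neq1].
  rewrite mulr1z scale1r f_act.
  have -> : VLin sB (inA B (a * f b - a0b sB a b)) =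
      VLin sB (inA B (a * f b)) - VLin sB (inA B (a0b sB a b)) by exact: linB VA _ _.
  have -> : opA (a0b sB a b) (1 - 2) vac = VLin sB (inA B (a0b sB a b)) by [].
  by rewrite opprB addrA subrK; apply: span_gen; exact: EgenA.
have E : opA (a0b sB a b) (m - 2) vac = 0 by apply: VLop_vac; lia.
rewrite E (lin0 (VLop_linr (inA B a) (-1))) scaler0 !subr0; exact: Span0.
Qed.

End IdealStability.

(** Induction on k through T_m D = D T_m + (m+1) T_(m-1). The set S is stable only for m >= 0; the
    index m = -1 is D itself, and there the scalar m + 1 is zero, so the index -2 never enters. *)
Lemma iter_closed (K : fieldType) (V : lmodType K) (S : V -> Prop) (D : V -> V) (T : int -> V -> V) :
  linear D -> (forall m, -1 <= m -> linear (T m)) -> T (-1) =1 D ->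
  (forall (m n : int) v, -1 <= m -> -1 <= n ->
     T m (T n v) - T n (T m v) = (m - n)%:~R *: T (m + n) v) ->
  (forall (m : int) e, 0 <= m -> S e -> S (T m e)) ->
  forall (m : int) k e, -1 <= m -> S e ->
  lin_span (fun v => exists j e, S e /\ v = iter j D e) (T m (iter k D e)).
Proof.
move=> Dl Tl TD Tbr TS; set C := lin_span _; have Cl : lin_closed C := lin_span_closed _.
have C_D v : C v -> C (D v).
  apply: span_map Dl _ => _ [j [e [Se ->]]].
  by apply: span_gen; exists j.+1, e.
move=> m k; elim: k m => [|k IH] m e m_ge Se.
  case: (ltrP m 0) => [m_lt|m_ge0]; last first.
    by apply: span_gen; exists 0%N, (T m e); split=> //; exact: TS.
  have -> : m = -1 by lia.
  by apply: span_gen; exists 1%N, e; rewrite TD.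
rewrite iterS -TD -(subrK (T (-1) (T m (iter k D e))) (T m _)) Tbr //.
apply: (lin_closedD Cl); last by rewrite TD; apply: C_D; exact: IH.
case: (ltrP m 0) => [m_lt|m_ge0]; last by apply: (lin_closedZ _ Cl); apply: IH => //; lia.
have -> : m = -1 by lia.
by rewrite subrr scale0r; exact: Cl.1.
Qed.

Section IdealStable.
Variables (K : fieldType) (A : algType K) (sA : supercomm_algebra A).
Variables (B : lmodType K) (sB : vertex_algebroid sA B).
Hypothesis char0 : forall n, n.+1%:R != 0 :> K.

Local Notation AB := (A * B)%type.
Local Notation VL := (VL sB).
Local Notation vac := (VLvac sB).
Local Notation opA a n v := (@VLop K A sA B sB (inA B a) n v).
Local Notation opB b n v := (@VLop K A sA B sB (inB A b) n v).

Variable YL : vertex_superalgebra VL.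
Hypothesis hYL : VL_structure YL.

Variable f : B -> A.
Hypothesis f_act : forall a b, f (va_act sB a b) = a * f b - a0b sB a b.
Variable T : int -> VL -> VL.
Hypothesis VO : virasoro_ops f T.

Local Notation IB := (lin_span (IB_gen YL)).

Lemma IB_act x v : IB v -> IB (VLact x v).
Proof.
apply: span_map (VLact_linr x) _ => _ [y [k [e [he ->]]]].
by apply: span_gen; exists (x * y), k, e; split; [exact: he | exact: esym (VLactM _ _ _)].
Qed.

Lemma IB_stable (m : int) v : -1 <= m -> IB_gen YL v -> IB (T m v).
Proof.
move=> m_ge [x [k [e [he ->]]]].
have Tl := vo_lin VO m_ge; have IBl : lin_closed IB := lin_span_closed _.
(* Membership of the vector itself is carried along, since commuting T_m past a mode leaves other
   modes applied to that vector. *)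
suff [] : IB (VLact x (iter k (vD YL) e)) /\ IB (T m (VLact x (iter k (vD YL) e))) by [].
apply: (VLact_mode_closed (P := fun w => IB w /\ IB (T m w))).
- exact: lin_closed_and IBl (lin_closed_preim Tl IBl).
- move=> u n w [Iw ITw]; split; first exact: IB_act.
  have IBop (u' : AB) n' w' : IB w' -> IB (VLop u' n' w') by exact: IB_act.
  have -> : T m (VLop u n w) = T m (opA u.1 n w) + T m (opB u.2 n w).
    by rewrite VLop_split; exact: linD Tl _ _.
  apply: (lin_closedD IBl).
    rewrite (vo_A VO u.1 n w m_ge); apply: (lin_closedB IBl); first exact: IBop.
    by apply: (lin_closedZ _ IBl); exact: IBop.
  rewrite (vo_B VO u.2 n w m_ge); apply: (lin_closedD IBl); last first.
    by apply: (lin_closedZ _ IBl); exact: IBop.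
  apply: (lin_closedB IBl); first exact: IBop.
  by apply: (lin_closedZ _ IBl); exact: IBop.
split.
  by apply: span_gen; exists 1, k, e; split; [exact: he | exact: esym (VLact1 _)].
have TS (j : int) e' : 0 <= j -> lin_span (@Egen K A sA B sB) e' ->
    lin_span (@Egen K A sA B sB) (T j e').
  move=> j_ge; have j_ge1 : -1 <= j by lia.
  apply: (lin_span_ind (lin_closed_preim (vo_lin VO j_ge1) (lin_span_closed _))).
  by move=> e'' he''; exact: (virasoro_Egen char0 f_act VO j_ge he'').
have := iter_closed (vD_linear YL) (vo_lin VO) (VL_translation char0 VO hYL)
  (VL_virasoro_bracket char0 VO) TS k m_ge he.
apply: (lin_span_ind IBl) => _ [j [e' [he' ->]]].
by apply: span_gen; exists 1, j, e'; split; [exact: he' | exact: esym (VLact1 _)].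
Qed.

End IdealStable.

Lemma comm_formula3 (K : fieldType) (V : lmodType K) (Y : vertex_superalgebra V)
    (L : int -> V -> V) (m : int) (x y0 y1 : V) :
  (forall n, n.+1%:R != 0 :> K) ->
  L (-1) x = vD Y x -> L 0 x = y0 -> L 1 x = y1 ->
  (forall n v, L m (vmode Y x n v) - vmode Y x n (L m v) =
     - ((m + n + 1)%:~R *: vmode Y x (m + n) v)
     + (m + 1)%:~R *: vmode Y y0 (m + n) v
     + binz (m + 1) 2 *: vmode Y y1 (m + n - 1) v) ->
  comm_formula Y L m 3 x.
Proof.
move=> char0 LD L0 L1 H n v; rewrite H !big_ord_recl big_ord0 /=.
rewrite -[0%:Z - 1]/(- 1 : int) LD -[(bump 0 0)%:Z - 1]/(0 : int) L0.
rewrite -[(bump 0 (bump 0 0))%:Z - 1]/(1 : int) L1 vmode_vD // binz0 scale1r.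
rewrite -[bump 0 (bump 0 0)]/2%N -[bump 0 0]/1%N binz1.
have -> : m + 1 - 0%:Z + n = m + n + 1 by ring.
have -> : m + 1 - 1%:Z + n = m + n by ring.
have -> : m + 1 - 2%:Z + n = m + n - 1 by ring.
by rewrite addrK addr0 addrA.
Qed.

(** On the B part the term (m+1) L(0) of the commutation formula turns the scalar -(m+n+1) into -n;
    on the A part it is absent. *)
Lemma comm_formula3_split (K : fieldType) (V : lmodType K) (Y : vertex_superalgebra V)
    (L : int -> V -> V) (m : int) (x xA xB y1 : V) :
  (forall n, n.+1%:R != 0 :> K) -> linear (L m) ->
  L (-1) x = vD Y x -> L 0 x = xB -> L 1 x = y1 -> x = xA + xB ->
  (forall n v, L m (vmode Y xA n v) =
     vmode Y xA n (L m v) - (m + n + 1)%:~R *: vmode Y xA (m + n) v) ->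
  (forall n v, L m (vmode Y xB n v) =
     vmode Y xB n (L m v) - n%:~R *: vmode Y xB (m + n) v
     + binz (m + 1) 2 *: vmode Y y1 (m + n - 1) v) ->
  comm_formula Y L m 3 x.
Proof.
move=> char0 Ll LD L0 L1 xE HA HB; apply: (comm_formula3 char0 LD L0 L1) => n v.
have split k w : vmode Y x k w = vmode Y xA k w + vmode Y xB k w.
  by rewrite xE (linD (vmode_linl Y k w)).
rewrite !split (linD Ll) HA HB.
move: (vmode Y xA n _) (vmode Y xB n _) (vmode Y xA (m + n) v) (vmode Y xB (m + n) v).
move=> p q r s; move: (_ *: vmode Y y1 _ v) => t.
have -> : n%:~R *: s = (m + n + 1)%:~R *: s - (m + 1)%:~R *: s.
  by rewrite -scalerBl -intrB; congr (_%:~R *: _); ring.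
rewrite opprB [- (p + q)]opprD.
rewrite [LHS](AC ((2*((1*2)*1))*2) ((1*7)*(3*8)*((2*5)*4*6))) /=.
by rewrite !subrr !add0r scalerDr opprD.
Qed.

(** * The operators on V_B *)

Section VirasoroOnVB.
Variables (K : fieldType) (A : algType K) (sA : supercomm_algebra A).
Variables (B : lmodType K) (sB : vertex_algebroid sA B).
Hypothesis char0 : forall n, n.+1%:R != 0 :> K.

Local Notation AB := (A * B)%type.
Local Notation VL := (VL sB).

Variable YL : vertex_superalgebra VL.
Hypothesis hYL : VL_structure YL.
Local Notation VB := (VB YL).
Variable YB : vertex_superalgebra VB.
Hypothesis hYB : VB_structure YB.
Local Notation pi := (@VBpi K A sA B sB YL).
Local Notation gen := (@VBin K A sA B sB YL).

Lemma VBpi_linear : linear pi.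
Proof. exact: qpi_linear. Qed.

Lemma VBpi_surj v : exists w, v = pi w.
Proof. by exists (qrepr v); exact: esym (qreprK _). Qed.

Lemma VBin_linear : linear gen.
Proof. exact: linear_comp VBpi_linear (VLop_linl (-1) (VLvac sB)). Qed.

Lemma VB_vacE : vvac YB = pi (VLvac sB).
Proof. by rewrite (VB_vac hYB) (VL_vac hYL). Qed.

Lemma VBpi_op (u : AB) n w : pi (VLop u n w) = vmode YB (gen u) n (pi w).
Proof. by rewrite /VBin (VB_mode hYB) (VL_mode hYL). Qed.

Lemma VBpi_D w : pi (vD YL w) = vD YB (pi w).
Proof. by rewrite /vD (VB_vac hYB) (VB_mode hYB). Qed.

Lemma VBin_parity : parity_map (ABsuper sB) YB gen.
Proof. by move=> p u hu; apply: (VB_parity hYB); exact: (VL_parity hYL). Qed.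

(** The relation e - 1 of E. Through it the prescribed values of L(0) and L(1) on A reach the
    vacuum. *)
Lemma VBin_one : gen (inA B 1) = vvac YB.
Proof.
rewrite VB_vacE; apply/qpi_eq/span_gen.
exists 1, 0%N, (VLin sB (inA B 1) - VLvac sB).
by split; [apply: span_gen; exact: EgenOne | exact: esym (VLact1 _)].
Qed.

Lemma negword_gen_word q d w :
  negword (sB := sB) q d w -> gen_word YB (ABsuper sB) gen q (pi w).
Proof.
elim=> [|p {}q a k {}d {}w ha hw IH|p {}q b k {}d {}w hb hw IH].
- rewrite -VB_vacE; exact: GenVac.
- by rewrite VBpi_op; apply: GenMode => //; exact: inA_homog.
- by rewrite VBpi_op; apply: GenMode => //; exact: inB_homog.
Qed.

Lemma VB_gen_span v : lin_span (fun w => exists p, gen_word YB (ABsuper sB) gen p w) v.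
Proof.
have [w ->] := VBpi_surj v; apply: (span_map VBpi_linear) (negword_span w).
move=> {}w [q [d hw]]; apply: span_gen; exists q; exact: negword_gen_word hw.
Qed.

Variable f : B -> A.
Hypothesis f_act : forall a b, f (va_act sB a b) = a * f b - a0b sB a b.
Variable T : int -> VL -> VL.
Hypothesis VO : virasoro_ops f T.

Lemma VB_operators : exists L : int -> VB -> VB, forall m : int, -1 <= m ->
  linear (L m) /\ forall w, L m (pi w) = pi (T m w).
Proof.
pose P (m : int) (L : VB -> VB) := -1 <= m ->
  linear L /\ forall w, L (pi w) = pi (T m w).
suff /choice[L LP] : forall m, exists L, P m L by exists L.
move=> m; case: (boolP (-1 <= m)) => [m_ge|m_lt]; last first.
  by exists (fun v => v) => m_ge; rewrite m_ge in m_lt.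
have [|L Ll LE] := quotv_lift (S := IB_gen YL) (linear_comp VBpi_linear (vo_lin VO m_ge)).
  by move=> v hv; apply: qpi0; exact: (IB_stable char0 hYL f_act VO m_ge hv).
by exists L => _; split.
Qed.

Variable L : int -> VB -> VB.
Hypothesis L_lin : forall m : int, -1 <= m -> linear (L m).
Hypothesis L_pi : forall (m : int) w, -1 <= m -> L m (pi w) = pi (T m w).

Lemma VB_L_vac (m : int) : -1 <= m -> L m (vvac YB) = 0.
Proof. by move=> m_ge; rewrite VB_vacE (L_pi _ m_ge) (vo_vac VO m_ge) (lin0 VBpi_linear). Qed.

Lemma VB_virp : virp_module L.
Proof.
split=> // m n m_ge n_ge v; have [w ->] := VBpi_surj v.
rewrite !(L_pi _ n_ge) !(L_pi _ m_ge) (L_pi _ n_ge) -(linB VBpi_linear).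
rewrite (VL_virasoro_bracket char0 VO w m_ge n_ge) (linZ VBpi_linear).
case: (eqVneq m n) => [->|mn]; first by rewrite subrr !scale0r.
by rewrite L_pi //; lia.
Qed.

Lemma VB_L_D v : L (-1) v = vD YB v.
Proof.
have [w ->] := VBpi_surj v; rewrite L_pi // -VBpi_D.
by rewrite (VL_translation char0 VO hYL).
Qed.

Lemma VBin_split (u : AB) : gen u = gen (inA B u.1) + gen (inB A u.2).
Proof.
have E1 : gen u = gen (inA B u.1 + inB A u.2) by apply: f_equal; exact: AB_split.
have E2 := linD VBin_linear (inA B u.1) (inB A u.2).
refine (eq_trans E1 _).
exact E2.
Qed.

Lemma VB_L_split (m : int) (u : AB) : -1 <= m ->
  L m (gen u) = L m (gen (inA B u.1)) + L m (gen (inB A u.2)).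
Proof.
move=> m_ge; exact: etrans (f_equal (L m) (VBin_split u)) (linD (L_lin m_ge) _ _).
Qed.

Lemma VB_L_genA (m : int) a : 0 <= m -> L m (gen (inA B a)) = 0.
Proof.
move=> m_ge; have m_ge1 : -1 <= m by lia.
apply: etrans (L_pi _ m_ge1) _; rewrite (virasoro_VLinA VO a m_ge).
exact: lin0 VBpi_linear.
Qed.

Lemma VB_L_genB (m : int) b : 0 <= m -> L m (gen (inB A b)) =
  if m == 0 then gen (inB A b) else if m == 1 then gen (inA B (f b)) else 0.
Proof.
move=> m_ge; have m_ge1 : -1 <= m by lia.
apply: etrans (L_pi _ m_ge1) _; rewrite (virasoro_VLinB char0 VO b m_ge).
case: ifP => // _; case: ifP => // _; exact: lin0 VBpi_linear.
Qed.

Lemma VB_L0 (u : AB) : L 0 (gen u) = gen (inB A u.2).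
Proof.
have m_ge1 : -1 <= 0 :> int by [].
have m_ge : 0 <= 0 :> int by [].
apply: etrans (VB_L_split u m_ge1) _.
exact: etrans (addr_eqs (VB_L_genA u.1 m_ge) (VB_L_genB u.2 m_ge)) (add0r _).
Qed.

Lemma VB_L1 (u : AB) : L 1 (gen u) = gen (inA B (f u.2)).
Proof.
have m_ge1 : -1 <= 1 :> int by [].
have m_ge : 0 <= 1 :> int by [].
apply: etrans (VB_L_split u m_ge1) _.
exact: etrans (addr_eqs (VB_L_genA u.1 m_ge) (VB_L_genB u.2 m_ge)) (add0r _).
Qed.

Lemma VB_L_mode (m : int) (u : AB) n w : -1 <= m ->
  L m (vmode YB (gen u) n (pi w)) = pi (T m (VLop u n w)).
Proof.
move=> m_ge; exact: etrans (f_equal (L m) (esym (VBpi_op u n w))) (L_pi _ m_ge).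
Qed.

Lemma VB_commA (m : int) a n v : -1 <= m ->
  L m (vmode YB (gen (inA B a)) n v) = vmode YB (gen (inA B a)) n (L m v)
    - (m + n + 1)%:~R *: vmode YB (gen (inA B a)) (m + n) v.
Proof.
move=> m_ge; have [w ->] := VBpi_surj v.
apply: etrans (VB_L_mode _ _ _ m_ge) _.
apply: etrans (f_equal pi (vo_A VO a n w m_ge)) _.
apply: etrans (linB VBpi_linear _ _) _.
apply: subr_eqs; last first.
  apply: etrans (linZ VBpi_linear _ _) _.
  exact: (f_equal (fun z => (m + n + 1)%:~R *: z) (VBpi_op _ _ _)).
apply: etrans (VBpi_op _ _ _) _.
exact: (f_equal (vmode YB _ n) (esym (L_pi w m_ge))).
Qed.

Lemma VB_commB (m : int) b n v : -1 <= m ->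
  L m (vmode YB (gen (inB A b)) n v) = vmode YB (gen (inB A b)) n (L m v)
    - n%:~R *: vmode YB (gen (inB A b)) (m + n) v
    + binz (m + 1) 2 *: vmode YB (gen (inA B (f b))) (m + n - 1) v.
Proof.
move=> m_ge; have [w ->] := VBpi_surj v.
apply: etrans (VB_L_mode _ _ _ m_ge) _.
apply: etrans (f_equal pi (vo_B VO b n w m_ge)) _.
apply: etrans (linD VBpi_linear _ _) _; apply: addr_eqs; last first.
  apply: etrans (linZ VBpi_linear _ _) _.
  exact: (f_equal (fun z => binz (m + 1) 2 *: z) (VBpi_op _ _ _)).
apply: etrans (linB VBpi_linear _ _) _; apply: subr_eqs; last first.
  apply: etrans (linZ VBpi_linear _ _) _.
  exact: (f_equal (fun z => n%:~R *: z) (VBpi_op _ _ _)).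
apply: etrans (VBpi_op _ _ _) _.
exact: (f_equal (vmode YB _ n) (esym (L_pi w m_ge))).
Qed.

Lemma VB_comm (m : int) (u : AB) : -1 <= m -> comm_formula YB L m 3 (gen u).
Proof.
move=> m_ge; apply: (comm_formula3_split char0 (L_lin m_ge) (VB_L_D _)
  (VB_L0 u) (VB_L1 u) (VBin_split u)) => n v.
  exact: VB_commA.
exact: VB_commB.
Qed.

Lemma VB_weight_span v : lin_span (fun w => exists d : nat, L 0 w = d%:R *: w) v.
Proof.
have m_ge : -1 <= 0 :> int by [].
have [w ->] := VBpi_surj v; apply: (span_map VBpi_linear) (negword_span w).
move=> {}w [q [d hw]]; apply: span_gen; exists d.
apply: etrans (L_pi w m_ge) _.
apply: etrans (f_equal pi (negword_weight VO hw)) _.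
exact: linZ VBpi_linear _ _.
Qed.

End VirasoroOnVB.

(** * The datum L(1) on A + B, existence and uniqueness *)

Section Extension.
Variables (K : fieldType) (A : algType K) (sA : supercomm_algebra A).
Variables (B : lmodType K) (sB : vertex_algebroid sA B).
Hypothesis char0 : forall n, n.+1%:R != 0 :> K.

Local Notation AB := (A * B)%type.
Local Notation VL := (VL sB).

Variable L0 L1 : AB -> AB.
Hypothesis hb : weight_b_module L0 L1.
Hypothesis hL1even : even_op (ABsuper sB) L1.
Hypothesis hL0A : forall a : A, L0 (inA B a) = 0.
Hypothesis hL0B : forall b : B, L0 (inB A b) = inB A b.
Hypothesis hL1der : forall a : A, L1 (inB A (va_der sB a)) = 0.
Hypothesis hL1prod0 : forall u v : B,
  L1 (prod0 sB (inB A u) (inB A v)) =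
  prod0 sB (L1 (inB A u)) (inB A v) + prod0 sB (inB A u) (L1 (inB A v)).
Hypothesis hL1act : forall (a : A) (b : B),
  L1 (inB A (va_act sB a b)) =
  ABact sB a (L1 (inB A b)) - prod0 sB (inA B a) (inB A b).

Definition L1BA (b : B) : A := (L1 (inB A b)).1.

Lemma L0E u : L0 u = inB A u.2.
Proof.
by rewrite {1}[u]AB_split (linD (b_L0_linear hb)) hL0A hL0B add0r.
Qed.

(** The bracket relation gives L(0) L(1) b = 0, and the weight 0 part of A + B is A. *)
Lemma L1_inB b : L1 (inB A b) = inA B (L1BA b).
Proof.
have := b_bracket hb (inB A b); rewrite hL0B !L0E => /(canRL (subrK _)).
rewrite addNr => H.
have H2 : (L1 (inB A b)).2 = 0 by have /= := f_equal snd H.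
by move: H2; rewrite /L1BA; case: (L1 _) => x y /= ->.
Qed.

(** L(1) a has weight -1, whereas only 0 and 1 occur; on the B component this reads 2 y = 0. *)
Lemma L1_inA a : L1 (inA B a) = 0.
Proof.
have := b_bracket hb (inA B a); rewrite hL0A (lin0 (b_L1_linear hb)) subr0 L0E.
case: (L1 _) => x y [/= /eqP]; rewrite eq_sym oppr_eq0 => /eqP -> /eqP.
rewrite -subr_eq0 opprK -mulr2n -scaler_nat scaler_eq0 (negbTE (char0 1)) /=.
by move=> /eqP ->.
Qed.

Lemma L1E u : L1 u = inA B (L1BA u.2).
Proof.
by rewrite {1}[u]AB_split (linD (b_L1_linear hb)) L1_inA L1_inB add0r.
Qed.

Lemma L1BA_linear : linear L1BA.
Proof.
exact: linear_comp (@linear_fst _ A B) (linear_comp (b_L1_linear hb) (@inB_linear _ A B)).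
Qed.

Lemma L1BA_even : parity_map sB sA L1BA.
Proof. by move=> p b hbp; have := hL1even (inB_homog hbp); rewrite L1_inB => -[]. Qed.

Lemma L1BA_der a : L1BA (va_der sB a) = 0.
Proof. by rewrite /L1BA hL1der. Qed.

Lemma L1BA_br u v :
  L1BA (va_br sB u v) = a0b sB (L1BA u) v + va_anchor sB u (L1BA v).
Proof.
have E : prod0 sB (inB A u) (inB A v) = inB A (va_br sB u v).
  congr (_, _); rewrite /= (lin0 ((va_anchor_bilin sB).2 _)).
  by rewrite (lin0 ((a0b_bilin sB).1 _)) addr0.
have := hL1prod0 u v; rewrite E !L1_inB prod0_inA_inB => /(f_equal fst) /= ->.
by rewrite (lin0 ((a0b_bilin sB).1 _)) addr0.
Qed.

Lemma L1BA_act a b : L1BA (va_act sB a b) = a * L1BA b - a0b sB a b.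
Proof. by rewrite /L1BA hL1act prod0_inA_inB. Qed.

Variable YL : vertex_superalgebra VL.
Hypothesis hYL : VL_structure YL.
Local Notation VB := (VB YL).
Variable YB : vertex_superalgebra VB.
Hypothesis hYB : VB_structure YB.
Hypothesis hL0even : even_op (ABsuper sB) L0.

Local Notation gen := (@VBin K A sA B sB YL).

Lemma extending_virp_gen L :
  extending_virp YB L0 L1 L -> gen_extension YB gen L0 L1 L.
Proof. case=> [[Ll _]] E0 E1 ED Ec; exact: GenExtension Ll ED E0 E1 Ec. Qed.

(** The indices 0 and 1 use that the vacuum comes from A. Index 0 already forces L'(0) = L(0), so
    for m >= 2 the bracket of L'(0) with L'(m) exhibits L'(m) 1 as a vector of weight -m for an
    operator without negative weights. *)
Lemma extending_virp_vac L L' : extending_virp YB L0 L1 L ->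
  (forall m : int, -1 <= m -> L m (vvac YB) = 0) ->
  (forall v, lin_span (fun w => exists d : nat, L 0 w = d%:R *: w) v) ->
  extending_virp YB L0 L1 L' ->
  forall m : int, -1 <= m -> L' m (vvac YB) = 0.
Proof.
move=> LE Lvac Lspan LE' m m_ge.
have m_ge0 : -1 <= 0 :> int by [].
have gen0 : gen 0 = 0 := lin0 (VBin_linear YL).
have L'0vac : L' 0 (vvac YB) = 0.
  by rewrite -(VBin_one hYL hYB) (ext_L0 LE') hL0A.
have : m = -1 \/ m = 0 \/ m = 1 \/ 2 <= m by lia.
move=> [->|[->//|[->|m_ge2]]].
- by rewrite (ext_D LE') vD_vac.
- by rewrite -(VBin_one hYL hYB) (ext_L1 LE') L1_inA.
have L'0 : L' 0 =1 L 0.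
  apply: (gext_unique (VB_gen_span hYL hYB) (extending_virp_gen LE)
    (extending_virp_gen LE') m_ge0).
  by rewrite L'0vac Lvac.
have [Ll _] := ext_virp LE; have [Ll' Lbr'] := ext_virp LE'.
apply: (neg_eigen_eq0 char0 (Ll 0 m_ge0) Lspan (n := - m)); first by lia.
have := Lbr' 0 m m_ge0 m_ge (vvac YB).
by rewrite L'0vac (lin0 (Ll' m m_ge)) subr0 !add0r L'0.
Qed.

Lemma virasoro_extension : exists L : int -> VB -> VB,
  [/\ extending_virp YB L0 L1 L,
      forall m : int, -1 <= m -> even_op YB (L m),
      forall L' : int -> VB -> VB, extending_virp YB L0 L1 L' ->
        forall m : int, -1 <= m -> L' m =1 L m
    & semi_conformal YB L].
Proof.
have [T VO] := virasoro_ops_exist L1BA_linear L1BA_even L1BA_der L1BA_br.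
have [L LP] := VB_operators char0 hYL L1BA_act VO.
have Ll (m : int) m_ge := (LP m m_ge).1.
have Lpi (m : int) w (m_ge : -1 <= m) := (LP m m_ge).2 w.
have LE : extending_virp YB L0 L1 L.
  split.
  - exact: (VB_virp char0 VO Ll Lpi).
  - by move=> u; rewrite L0E; exact: (VB_L0 char0 VO Ll Lpi).
  - by move=> u; rewrite L1E; exact: (VB_L1 char0 VO Ll Lpi).
  - exact: (VB_L_D char0 hYL hYB VO Lpi).
  - by move=> m u; exact: (VB_comm char0 hYL hYB VO Ll Lpi).
have LG := extending_virp_gen LE.
have Lvac := VB_L_vac hYL hYB VO Lpi.
have Lspan := VB_weight_span VO Lpi.
have gens := VB_gen_span hYL hYB.
have m_ge0 : -1 <= 0 :> int by [].
exists L; split=> //.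
- move=> m m_ge.
  exact: (gext_even (VBin_parity hYL hYB) hL0even hL1even gens LG m_ge (Lvac m m_ge)).
- move=> L' LE' m m_ge; apply: (gext_unique gens LG (extending_virp_gen LE') m_ge).
  by rewrite Lvac // (extending_virp_vac LE Lvac Lspan LE').
split.
- exact: (ext_virp LE).
- exact: (eigen_direct_sum char0 (Ll 0 m_ge0) Lspan).
- exists 1 => n n_ge v Lv; apply: (neg_eigen_eq0 char0 (Ll 0 m_ge0) Lspan _ Lv); lia.
- exact: (ext_D LE).
move=> m u m_ge.
exact: (gext_sc_comm char0 (VBin_parity hYL hYB) hL0even hL1even gens LG Lvac).
Qed.

End Extension.

Local Open Scope complex_scope.

Theorem theorem3p6 (R : realType)
  (A : algType R[i]) (sA : supercomm_algebra A)
  (B : lmodType R[i]) (sB : vertex_algebroid sA B)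
  (YL : vertex_superalgebra (VL sB)) (hYL : VL_structure YL)
  (YB : vertex_superalgebra (VB YL)) (hYB : VB_structure YB)
  (hdeg : VB_low_degrees YL)
  (L0 L1 : A * B -> A * B)
  (hb : weight_b_module L0 L1)
  (hL0even : even_op (ABsuper sB) L0) (hL1even : even_op (ABsuper sB) L1)
  (hL0A : forall a : A, L0 (inA B a) = 0)
  (hL0B : forall b : B, L0 (inB A b) = inB A b)
  (hL1der : forall a : A, L1 (inB A (va_der sB a)) = 0)
  (hL1prod0 : forall u v : B,
    L1 (prod0 sB (inB A u) (inB A v)) =
    prod0 sB (L1 (inB A u)) (inB A v) + prod0 sB (inB A u) (L1 (inB A v)))
  (hL1act : forall (a : A) (b : B),
    L1 (inB A (va_act sB a b)) =
    ABact sB a (L1 (inB A b)) - prod0 sB (inA B a) (inB A b)) :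
  exists L : int -> VB YL -> VB YL,
    [/\ extending_virp YB L0 L1 L,
        forall m : int, -1 <= m -> even_op YB (L m),
        forall L' : int -> VB YL -> VB YL, extending_virp YB L0 L1 L' ->
          forall m : int, -1 <= m -> L' m =1 L m
      & semi_conformal YB L].
Proof.
apply: (virasoro_extension _ hb hL1even hL0A hL0B hL1der hL1prod0 hL1act hYL hYB hL0even).
by move=> n; rewrite pnatr_eq0.
Qed.
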